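(* Let $s\ge3$ be an integer. There is a constant $c_s$ depending only on $s$ such that the following holds. Let $h_n:\mathbb{R}^n\to\mathbb{R}$, $n\ge1$, be a sequence of functions satisfying, for all $n\ge1$ and all real arguments, (i) $h_{n+1}(\varepsilon_1,\dots,\varepsilon_j,0,\varepsilon_{j+1},\dots,\varepsilon_n)=h_n(\varepsilon_1,\dots,\varepsilon_j,\varepsilon_{j+1},\dots,\varepsilon_n)$ for every position $j$ of the inserted zero; (ii) $\frac{\partial}{\partial\varepsilon_j}h_n(\varepsilon_1,\dots,\varepsilon_j,\dots,\varepsilon_n)\big|_{\varepsilon_j=0}=0$ for all $j=1,\dots,n$; (iii) $h_n(\varepsilon_{\pi(1)},\dots,\varepsilon_{\pi(n)})=h_n(\varepsilon_1,\dots,\varepsilon_n)$ for all permutations $\pi\in S_n$. Suppose that for some constant $B>0$ $$|D^\alpha h_n(\varepsilon_1,\dots,\varepsilon_n)|\le B$$ for all $n\ge1$, all $\varepsilon_1,\dots,\varepsilon_n\in\mathbb{R}$, and all $\alpha=(\alpha_1,\dots,\alpha_r)$ with $r\le s$ and $$\alpha_j\ge2,\quad j=1,\dots,r,\qquad\sum_{j=1}^r(\alpha_j-2)\le s-2 .$$ Then the limit functions $h_\infty$ and $h_\infty(\lambda_1,\dots,\lambda_l)$, $1\le l\le s-3$ (defined in the context), and their derivatives at zero used below exist, and for every $n\ge1$ and every $\varepsilon=(\varepsilon_1,\dots,\varepsilon_n)\in\mathbb{R}^n$ with $|\varepsilon|_2=1$, $$h_n(\varepsilon_1,\dots,\varepsilon_n)=h_\infty+\sum_{l=1}^{s-3}P_l(\varepsilon^{*}\kappa_{*})\,h_\infty(\lambda_1,\dots,\lambda_l)\Big|_{\lambda_1=\dots=\lambda_l=0}+R_s,$$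 where $P_l(\varepsilon^{*}\kappa_{*})$ is the Edgeworth polynomial (defined in the context) with $\varepsilon^{*}=(\varepsilon^3,\dots,\varepsilon^{l+2})$ and $\kappa_{*}=(\kappa_3,\dots,\kappa_{l+2})$, and $$|R_s|\le c_s\cdot B\cdot|\varepsilon|^s .$$
   Context: Power sums. For $\varepsilon=(\varepsilon_1,\dots,\varepsilon_n)\in\mathbb{R}^n$ and an integer $d\ge1$: $\varepsilon^d:=\sum_{i=1}^n\varepsilon_i^d$, $|\varepsilon|^d:=\sum_{i=1}^n|\varepsilon_i|^d$ (power sums, not powers of a norm), and $|\varepsilon|_d:=(|\varepsilon|^d)^{1/d}$. In particular $|\varepsilon|_2$ is the Euclidean norm. Derivatives. For a vector $\alpha=(\alpha_1,\dots,\alpha_r)$ of nonnegative integers (with $r\le n$), $D^\alpha=\frac{\partial^{\alpha_1}}{\partial\varepsilon_1^{\alpha_1}}\cdots\frac{\partial^{\alpha_r}}{\partial\varepsilon_r^{\alpha_r}}$. The partial derivatives that appear in the hypotheses are understood to exist. $S_n$ is the symmetric group on $\{1,\dots,n\}$. Limit functions. For an integer $l\ge0$ and real $\lambda_1,\dots,\lambda_l,\lambda$, $$h_\infty(\lambda_1,\dots,\lambda_l,\lambda):=\lim_{k\to\infty}h_{k+l}\left(\lambda_1,\dots,\lambda_l,\frac{\lambda}{\sqrt k},\dots,\frac{\lambda}{\sqrt k}\right)$$ (with $k$ arguments equal to $\lambda/\sqrt k$). Since $|\varepsilon|_2=1$, the last argument is always taken to be $\lambda=|\varepsilon|_2=1$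 and is dropped from the notation: $h_\infty(\lambda_1,\dots,\lambda_l)$ stands for $h_\infty(\lambda_1,\dots,\lambda_l,1)$, and $h_\infty$ without arguments stands for $\lim_{k\to\infty}h_k(k^{-1/2},\dots,k^{-1/2})$. Cumulant differential operators. Let $D^2,D^3,D^4,\dots$ be regarded as independent commuting formal symbols (a product $D^pD^q$ is not identified with $D^{p+q}$). The operators $\kappa_p=\kappa_p(D)$, $p\ge2$, are the polynomials in these symbols defined by the formal power series identity in a formal variable $\mu$ $$\sum_{p=2}^\infty\frac{1}{p!}\mu^p\kappa_p(D)=\ln\left(1+\sum_{p=2}^\infty\frac{1}{p!}\mu^pD^p\right).$$ For example $\kappa_2=D^2$, $\kappa_3=D^3$, $\kappa_4=D^4-3D^2D^2$. Action on $h_\infty$. A monomial $D^{p_1}D^{p_2}\cdots D^{p_q}$ with $q\le l$ acts on $h_\infty(\lambda_1,\dots,\lambda_l)$ by differentiating with respect to distinct variables, i.e. as $\frac{\partial^{p_1}}{\partial\lambda_1^{p_1}}\frac{\partial^{p_2}}{\partial\lambda_2^{p_2}}\cdots\frac{\partial^{p_q}}{\partial\lambda_q^{p_q}}$, after which all $\lambda_i$ are set to $0$ (by symmetry of $h_\infty$ in $\lambda_1,\dots,\lambda_l$ the ordering is irrelevant); this is extended linearly. Every monomial occurring in $P_l$ below has at most $l$ factors. Edgeworth polynomials. For variables $\tau_*=(\tau_3,\tau_4,\dots)$ the polynomials $P_r(\tau_*\kappa_* )$ are defined by the formal power series identity in a formal variable $\mu$ $$\sum_{r=0}^\infty\mu^rP_r(\tau_*\kappa_*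 )=\exp\left(\sum_{r=3}^\infty\frac{1}{r!}\mu^{r-2}\kappa_r\tau_r\right),$$ so that for $r\ge1$ $$P_r(\tau_*\kappa_* )=\sum_{m=1}^r\frac{1}{m!}\sum_{j_1,\dots,j_m}\prod_{q=1}^m\frac{\tau_{j_q+2}\,\kappa_{j_q+2}}{(j_q+2)!},$$ the inner sum being over all $m$-tuples of positive integers $(j_1,\dots,j_m)$ with $j_1+\dots+j_m=r$; $P_r$ depends only on $\tau_3,\dots,\tau_{r+2}$ and $\kappa_3,\dots,\kappa_{r+2}$. For example $P_1=\frac16\tau_3\kappa_3$ and $P_2=\frac1{24}\tau_4\kappa_4+\frac1{72}\tau_3^2\kappa_3\kappa_3$. $P_l(\varepsilon^*\kappa_* )$ is obtained by substituting the power sum $\tau_p=\varepsilon^p=\sum_i\varepsilon_i^p$ for each $p$. *)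

(* Defs.v *)
From HB Require Import structures.
From mathcomp Require Import all_boot all_order all_algebra.
(* monalg has to be imported before all_analysis: in the other order two
   notation levels clash. *)
From mathcomp Require Import finmap monalg.
From mathcomp Require Import all_classical all_reals all_analysis.

Set Implicit Arguments.
Unset Strict Implicit.
Unset Printing Implicit Defensive.

Import Order.TTheory GRing.Theory Num.Theory.
Import numFieldNormedType.Exports.

Local Open Scope classical_set_scope.
Local Open Scope ring_scope.

Section PowerSums.
Variables (R : realType) (n : nat).
Implicit Types (x : 'rV[R]_n) (d : nat).

Definition psum x d : R := \sum_i x 0 i ^+ d.

Definition abs_psum x d : R := \sum_i `|x 0 i| ^+ d.

Definition pnorm x d : R := abs_psum x d `^ d%:R^-1.

End PowerSums.

Section PartialDerivatives.
Variables (R : realType) (n : nat).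
Implicit Types (f : 'rV[R]_n -> R) (w : seq 'I_n) (alpha : seq nat).

(* A word [:: i_1; ...; i_k] stands for the operator d_{i_1} ... d_{i_k}; the
   rightmost letter is applied first. *)
Fixpoint deriv_word w f : 'rV[R]_n -> R :=
  if w is i :: w' then 'D_(delta_mx 0 i) (deriv_word w' f) else f.

(* The library's 'D_v is total, with a junk value where the limit does not
   exist, so existence is recorded separately. *)
Fixpoint ex_deriv_word w f (x : 'rV[R]_n) : Prop :=
  if w is i :: w' then
    (\forall y \near x, ex_deriv_word w' f y) /\
    derivable (deriv_word w' f) x (delta_mx 0 i)
  else True.

(* The list alpha = [:: a_1; ...; a_r] is a multi-index on the first r of the n
   variables; it is only meaningful for size alpha <= n. *)
Definition word_of alpha : seq 'I_n :=
  flatten [seq nseq (nth 0%N alpha i) i | i : 'I_n <- enum 'I_n].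

Definition Dmulti alpha f := deriv_word (word_of alpha) f.

Definition ex_Dmulti alpha f x := ex_deriv_word (word_of alpha) f x.

End PartialDerivatives.

Definition admissible (s : nat) (alpha : seq nat) : bool :=
  [&& (0 < size alpha)%N, (size alpha <= s)%N, all (leq 2) alpha
    & (\sum_(a <- alpha) (a - 2) <= s - 2)%N].

Definition insert0 (R : realType) n (j : 'I_n.+1) (x : 'rV[R]_n) :
    'rV[R]_n.+1 :=
  \row_i (if unlift j i is Some k then x 0 k else 0).

Section LimitFunctions.
Variables (R : realType) (h : forall n, 'rV[R]_n -> R) (l : nat).
Implicit Types (x : 'rV[R]_l) (lam : R).

Definition hinf_seq x lam (k : nat) : R :=
  h (row_mx x (const_mx (lam / Num.sqrt k%:R) : 'rV[R]_k)).

Definition hinf_gen x lam : R := limn (hinf_seq x lam).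

Definition hinf x : R := hinf_gen x 1.

End LimitFunctions.

(* Formal power series over a commutative R-algebra are given by their
   coefficient functions u : nat -> A, with u 0 = 0 below. The coefficient of
   mu^p in ln (1 + u) and in exp u only involves the first p + 1 coefficients
   of u and its powers of exponent at most p, so it can be read off from the
   truncation of u, which is a polynomial. *)
Section FormalSeries.
Variables (R : realType) (A : comAlgType R).
Implicit Types (u : nat -> A) (p : nat).

Definition fps_ln1p u p : A :=
  \sum_(1 <= m < p.+1)
    ((-1) ^+ m.-1 / m%:R) *: ((\poly_(i < p.+1) u i) ^+ m)`_p.

Definition fps_exp u p : A :=
  \sum_(0 <= m < p.+1) (m`!%:R)^-1 *: ((\poly_(i < p.+1) u i) ^+ m)`_p.

End FormalSeries.

Section Edgeworth.
Variable R : realType.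

(* Polynomials in countably many commuting symbols, the p-th of which is D^p
   (the symbols of index 0 and 1 are not used). *)
Definition dpoly := {malg R[{cmonom nat}]}.

Definition dsym (p : nat) : dpoly := mkmalgU (ucm p) 1.

Definition kappa (p : nat) : dpoly :=
  (p`!)%:R *:
    fps_ln1p (fun q => if (2 <= q)%N then (q`!)%:R^-1 *: dsym q else 0) p.

(* The coefficient tau_r kappa_r / r! belongs to mu^(r - 2). *)
Definition edgeworth (tau : nat -> R) (l : nat) : dpoly :=
  fps_exp (fun j => if (1 <= j)%N
                    then (tau j.+2 / (j.+2)`!%:R) *: kappa j.+2 else 0) l.

(* The factors p_1 <= ... <= p_q of D^{p_1} ... D^{p_q}, with repetitions. *)
Definition factors (m : {cmonom nat}) : seq nat :=
  flatten [seq nseq (m p) p | p <- sort leq (finsupp m)].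

(* The monomial D^{p_1} ... D^{p_q} acts as d_1^{p_1} ... d_q^{p_q}, evaluated
   at 0. This requires q <= l, which holds for the monomials of edgeworth tau l:
   kappa_(j+2) has at most 1 + j./2 <= j factors for j >= 1. *)
Definition dpoly_at0 l (P : dpoly) (f : 'rV[R]_l -> R) : R :=
  \sum_(m <- msupp P) mcoeff m P * Dmulti (factors m) f 0.

End Edgeworth.

(* Main.v *)
Require Import Defs.
From HB Require Import structures.
From mathcomp Require Import all_boot all_order all_algebra perm.
From mathcomp Require Import finmap monalg.
From mathcomp Require Import all_classical all_reals all_analysis.
From mathcomp Require Import ring lra zify.

Set Implicit Arguments.
Unset Strict Implicit.
Unset Printing Implicit Defensive.

Import Order.TTheory GRing.Theory Num.Theory.
Import numFieldNormedType.Exports.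

Local Open Scope classical_set_scope.
Local Open Scope ring_scope.

(** Let T_t denote the insertion of an argument t into a symmetric function of
    finitely many reals, and D^p the insertion of an argument in which one
    differentiates p times at 0. Zero arguments may be deleted and the first
    derivatives at 0 vanish, so Taylor expansion reads
      T_t = 1 + sum_(p >= 2) t^p D^p / p! = exp (sum_(p >= 2) t^p kappa_p / p!),
    and, these operators being commutative, formally
      h_n(eps) = T_(eps_1) ... T_(eps_n) h = exp (sum_p eps^p kappa_p / p!) h
    depends on the power sums eps^p only. The limit functions are the case where
    the second power sum is 1 and the higher ones are 0, and the theorem is the
    expansion of the factor exp (sum_(p >= 3) eps^p kappa_p / p!) between the two.

    To turn this into a proof one moves from the flat vector, with N arguments
    N^(-1/2), to eps along the curve (sin u * eps, cos u * flat), along which the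
    second power sum stays equal to 1. Since kappa_p is the coefficient of the
    logarithmic derivative of T_t ([act_log_derivative]), the derivative of the
    function along the curve is the sum over p >= 3 of the speeds of the power
    sums times kappa_p h / (p-1)!, up to an error of the order of
    |eps|^s + N^(-1/2) ([curve_velocity]); kappa_2 does not appear. The Edgeworth
    polynomials of the power sums sin^p u * eps^p satisfy the same differential
    equation exactly ([is_derive_edgeworth]). As kappa_p h is a function of the
    same kind, whose expansion is needed to an order lower by p - 2, induction on
    the order gives the expansion of the function along the curve, with a
    constant that depends on the order only ([curve_expansion]). At order 0 it
    compares two flat vectors, whence the existence of the limits; at order
    s - 3, for N tending to infinity, it is the theorem. Products of power sums
    are absorbed by |eps|^s because |eps|_2 = 1 ([abs_power_sumM]).

    The bounds concern only derivatives whose orders are at least 2 in each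
    variable involved, so all the classical facts have to be obtained without
    continuity of mixed derivatives. Partial derivatives commute because they are
    limits of iterated differences, which do ([derive1n_comm]); derivatives
    inherit the vanishing of the first derivative at 0 by the same token
    ([reg_pd]); and a bound on the next derivative makes the derivatives converge
    in the limit N -> oo ([limit_family_pds]). Each of these uses one unit more of
    differentiability than the operation itself, which is available because the
    Edgeworth polynomials involve derivatives of weight at most s - 3. *)

(** * Calculus in one variable *)

Section OneVariable.
Variable R : realType.
Implicit Types (f g : R -> R) (B C h t x y : R) (p q : nat).

(** All derivatives below are computed from quantitative estimates; a quadratic
    remainder is the form in which these arise. *)
Lemma is_derive_quad f x d C e : 0 < e ->
  (forall h, `|h| <= e -> `|f (h + x) - f x - h * d| <= C * h ^+ 2) ->
  is_derive x 1 f d.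
Proof.
move=> e0 fq.
have cv : h^-1 *: (f (h *: 1 + x) - f x) @[h --> 0^'] --> d.
  apply/cvgrPdist_le => eps eps0.
  have C1 : 0 < `|C| + 1 by rewrite ltr_wpDl.
  near=> h.
  have h0 : h != 0 by near: h; exact: nbhs_dnbhs_neq.
  have he : `|h| <= e by near: h; apply: dnbhs0_le.
  have hC : `|h| <= eps / (`|C| + 1).
    by near: h; apply: dnbhs0_le; rewrite divr_gt0.
  rewrite distrC /GRing.scale/= mulr1.
  have -> : h^-1 * (f (h + x) - f x) - d = h^-1 * (f (h + x) - f x - h * d).
    by rewrite [RHS]mulrBr mulKf.
  rewrite normrM normfV ler_pdivrMl ?normr_gt0//.
  apply: (le_trans (fq _ he)).
  rewrite -(real_normK (num_real h)) expr2.
  apply: (@le_trans _ _ (`|h| * (`|h| * (`|C| + 1)))).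
    have := ler_norm C; have := normr_ge0 h; nra.
  by rewrite ler_wpM2l// -ler_pdivlMr.
split; first exact: cvgP cv.
by apply: cvg_lim cv.
Unshelve. all: by end_near. Qed.

Definition smooth p f := forall q x, (q < p)%N -> derivable (derive1n q f) x 1.

Lemma smoothS p f :
  smooth p.+1 f <-> (forall x, derivable f x 1) /\ smooth p (derive1 f).
Proof.
split=> [sf|[f1 sf]].
  split=> [x|q x qp]; first exact: (sf 0%N).
  by rewrite -derive1Sn; apply: sf.
case=> [|q] x qp; first exact: f1.
by rewrite derive1Sn; apply: sf.
Qed.

Lemma smooth_le p q f : (p <= q)%N -> smooth q f -> smooth p f.
Proof. by move=> pq sf k x kp; apply: sf; apply: leq_trans kp pq. Qed.

Lemma is_derive_derive1 f x : derivable f x 1 -> is_derive x 1 f (derive1 f x).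
Proof. by move=> fx; rewrite derive1E; apply/derivableP. Qed.

(** The mean value theorem for x and y in either order. Both bounds on the
    intermediate point are needed: one for local estimates, the other for
    estimates in terms of the distance to 0. *)
Lemma MVT_between f x y : (forall t, derivable f t 1) ->
  exists t, [/\ `|t - x| <= `|y - x|, `|t| <= Num.max `|x| `|y| &
    f y - f x = derive1 f t * (y - x)].
Proof.
move=> df.
have cf : continuous f.
  by move=> t; apply: differentiable_continuous; apply/derivable1_diffP.
have key a b : a <= b ->
    exists2 c, c \in `[a, b] & f b - f a = derive1 f c * (b - a).
  move=> ab; apply: MVT_segment => //.
    by move=> t _; apply: is_derive_derive1.
  exact: continuous_subspaceT.
have hmax (a b c : R) : a <= c <= b -> `|c| <= Num.max `|a| `|b|.
  move=> /andP[ac cb]; rewrite le_max.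
  have [c0|c0] := lerP 0 c.
    by rewrite (ger0_norm c0) (le_trans cb (ler_norm _)) orbT.
  by rewrite (ltr0_norm c0) -normrN (le_trans _ (ler_norm _))// lerN2.
have [xy|/ltW yx] := lerP x y.
  have [c cab E] := key _ _ xy; exists c; split => //.
    have [xc cy] : x <= c /\ c <= y by move: cab; rewrite in_itv/= => /andP[].
    by rewrite !ger0_norm; lra.
  by apply: hmax; move: cab; rewrite in_itv.
have [c cab E] := key _ _ yx; exists c; split.
- have [xc cy] : y <= c /\ c <= x by move: cab; rewrite in_itv/= => /andP[].
  by rewrite !ler0_norm; lra.
- by rewrite maxC; apply: hmax; move: cab; rewrite in_itv.
- by rewrite -opprB E -mulrN opprB.
Qed.

Lemma derivative_bound_lipschitz f B x y : (forall t, derivable f t 1) ->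
  (forall t, `|derive1 f t| <= B) -> `|f y - f x| <= B * `|y - x|.
Proof.
move=> df fB; have [t [_ _ ->]] := MVT_between x y df.
by rewrite normrM ler_wpM2r.
Qed.

Lemma derivative_bound_quad f B x y : smooth 2 f ->
  (forall t, `|derive1n 2 f t| <= B) ->
  `|f y - f x - (y - x) * derive1 f x| <= B * (y - x) ^+ 2.
Proof.
move=> /smoothS[df /smoothS[ddf _]] fB.
have B0 : 0 <= B by apply: le_trans (fB 0).
have [t [tx _ ->]] := MVT_between x y df.
rewrite [_ * (y - x)]mulrC -mulrBr normrM.
have := derivative_bound_lipschitz x t ddf fB => tB.
rewrite -(real_normK (num_real (y - x))) expr2 mulrA [B * _]mulrC -mulrA ler_wpM2l//.
exact: le_trans tB (ler_wpM2l B0 tx).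
Qed.

(** The mean value inequality is applied p times, each time to the difference
    between a derivative of f and its own Taylor polynomial; dropping the
    factor 1 / p! makes every step the same. *)
Lemma taylor0 p f B t : smooth p f ->
  (forall t, `|derive1n p f t| <= B) ->
  `|f t - \sum_(q < p) t ^+ q / q`!%:R * derive1n q f 0| <= B * `|t| ^+ p.
Proof.
elim: p f t => [|p IHp] f t sf fB.
  by rewrite big_ord0 subr0 expr0 mulr1.
have /smoothS[df sf'] := sf.
have B0 : 0 <= B by apply: le_trans (fB 0).
have fB' u : `|derive1n p (derive1 f) u| <= B by rewrite -derive1Sn.
have IH t' := IHp (derive1 f) t' sf' fB'.
pose P : {poly R} := \poly_(q < p.+1) (q`!%:R^-1 * derive1n q f 0).
pose r u := f u - P.[u].
have PE u : P.[u] = \sum_(q < p.+1) u ^+ q / q`!%:R * derive1n q f 0.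
  by rewrite horner_poly; apply: eq_bigr => q _; rewrite mulrC mulrA.
have P'E u : P^`().[u] = \sum_(q < p) u ^+ q / q`!%:R * derive1n q (derive1 f) 0.
  have -> : P^`() = \poly_(q < p) (q`!%:R^-1 * derive1n q (derive1 f) 0).
    apply/polyP => q; rewrite coef_deriv !coef_poly ltnS.
    case: ltnP => qp; last by rewrite mul0rn.
    rewrite -derive1Sn -mulrnAl; congr (_ * _).
    by rewrite factS natrM invfM -[LHS]mulr_natl mulrA mulfV ?mul1r// pnatr_eq0.
  by rewrite horner_poly; apply: eq_bigr => q _; rewrite mulrC mulrA.
have dr u : is_derive u (1:R) r (derive1 f u - P^`().[u]).
  have -> : P^`().[u] = derive1 (horner P) u by rewrite -derivE.
  apply: is_deriveB; first exact: is_derive_derive1.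
  by apply: is_derive_derive1; apply: derivable_horner.
have r0 : r 0 = 0.
  rewrite /r PE big_ord_recl/= expr0 mul1r invr1 mul1r.
  by rewrite big1 ?addr0 ?subrr// => q _; rewrite expr0n/= mul0r mul0r.
have [u [_ ut]] := MVT_between 0 t (fun u => @ex_derive _ _ _ _ _ _ _ (dr u)).
have dru := dr u.
rewrite r0 !subr0 {1}/r PE derive1E derive_val P'E => ->.
rewrite normrM exprSr mulrA ler_wpM2r//.
apply: (le_trans (IH u)); rewrite ler_wpM2l// lerXn2r ?nnegrE//.
by move: ut; rewrite normr0 max_r.
Qed.
End OneVariable.

(** * Finite differences *)

Section FiniteDifferences.
Variable R : realType.
Implicit Types (f g : R -> R) (B C h t x y : R) (p q : nat).

Lemma derive1_shift f h : derive1 (fun x => f (x + h)) = fun x => derive1 f (x + h).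
Proof.
apply/funext => x; rewrite !derive1E /derive.
suff -> : (fun k : R => k^-1 *:
      (((fun y => f (y + h)) \o shift x) (k *: 1) - f (x + h))) =
    (fun k : R => k^-1 *: ((f \o shift (x + h)) (k *: 1) - f (x + h))) by [].
by apply/funext => k /=; rewrite addrA.
Qed.

Lemma derivable_shift f h x : derivable f (x + h) 1 ->
  derivable (fun x => f (x + h)) x 1.
Proof.
rewrite /derivable.
suff -> : (fun k : R => k^-1 *:
      (((fun y => f (y + h)) \o shift x) (k *: 1) - f (x + h))) =
    (fun k : R => k^-1 *: ((f \o shift (x + h)) (k *: 1) - f (x + h))) by [].
by apply/funext => k /=; rewrite addrA.
Qed.

Lemma derive1n_shift p f h :
  derive1n p (fun x => f (x + h)) = fun x => derive1n p f (x + h).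
Proof. by elim: p => // p IHp; rewrite !derive1nS IHp derive1_shift. Qed.

Lemma smooth_shift p f h : smooth p f -> smooth p (fun x => f (x + h)).
Proof.
move=> sf q x qp; rewrite derive1n_shift.
by apply: derivable_shift; apply: sf.
Qed.

Lemma derive1nB p f g : smooth p f -> smooth p g ->
  derive1n p (fun x => f x - g x) = fun x => derive1n p f x - derive1n p g x.
Proof.
elim: p => // p IHp sf sg; rewrite !derive1nS IHp; last 2 first.
- exact: smooth_le sf.
- exact: smooth_le sg.
apply/funext => x; rewrite !derive1E; apply: deriveB; [exact: sf|exact: sg].
Qed.

Lemma smoothB p f g : smooth p f -> smooth p g -> smooth p (fun x => f x - g x).
Proof.
move=> sf sg q x qp; rewrite derive1nB.
- by apply: derivableB; [exact: sf|exact: sg].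
- exact: smooth_le (ltnW qp) sf.
- exact: smooth_le (ltnW qp) sg.
Qed.

Definition fdiff h f : R -> R := fun x => f (x + h) - f x.

Lemma smooth_diff p h f : smooth p f -> smooth p (fdiff h f).
Proof. by move=> sf; apply: smoothB => //; apply: smooth_shift. Qed.

Lemma derive1n_diff p h f : smooth p f ->
  derive1n p (fdiff h f) = fdiff h (derive1n p f).
Proof. by move=> sf; rewrite derive1nB ?derive1n_shift//; apply: smooth_shift. Qed.

(** Each difference trades one derivative for a factor h. *)
Lemma iter_diff_le p h f B x : smooth p f -> (forall t, `|derive1n p f t| <= B) ->
  `|iter p (fdiff h) f x| <= B * `|h| ^+ p.
Proof.
elim: p f B => [|p IHp] f B sf fB; first by rewrite expr0 mulr1; apply: fB.
rewrite iterSr exprS mulrA; apply: IHp.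
  by apply: smooth_diff; apply: smooth_le sf.
move=> t; rewrite derive1n_diff; last exact: smooth_le sf.
have := derivative_bound_lipschitz t (t + h) (fun u => sf p u (ltnSn _)) fB.
by rewrite [X in _ * `|X|]addrC addKr.
Qed.

(** The p-th difference quotient approximates the p-th derivative at a rate
    governed by the derivative of order p + 1 alone. *)
Lemma iter_diff_approx p h f B x : smooth p.+1 f ->
  (forall t, `|derive1n p.+1 f t| <= B) ->
  `|iter p (fdiff h) f x - h ^+ p * derive1n p f x| <= p%:R * B * `|h| ^+ p.+1.
Proof.
elim: p f B => [|p IHp] f B sf fB.
  by rewrite expr0 mul1r subrr normr0 !mul0r.
have B0 : 0 <= B by apply: le_trans (fB 0).
have sf1 : smooth p.+1 f by apply: smooth_le sf.
have sd : smooth p.+1 (fdiff h f) by apply: smooth_diff.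
have dB t : `|derive1n p.+1 (fdiff h f) t| <= B * `|h|.
  rewrite derive1n_diff//.
  have := derivative_bound_lipschitz t (t + h) (fun u => sf p.+1 u (ltnSn _)) fB.
  by rewrite [X in _ * `|X|]addrC addKr.
have H1 := IHp _ _ sd dB.
rewrite derive1n_diff in H1; last exact: smooth_le sf1.
have H2 : `|fdiff h (derive1n p f) x - h * derive1n p.+1 f x| <= B * `|h| ^+ 2.
  have s2 : smooth 2 (derive1n p f).
    by move=> q u q2; rewrite /derive1n -iterD; apply: sf; rewrite addnC -addn2 ltn_add2l.
  have := @derivative_bound_quad _ (derive1n p f) B x (x + h) s2 fB.
  have -> : x + h - x = h by rewrite addrC addKr.
  by rewrite real_normK// num_real.
rewrite iterSr.
have -> : iter p (fdiff h) (fdiff h f) x - h ^+ p.+1 * derive1n p.+1 f x =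
   (iter p (fdiff h) (fdiff h f) x - h ^+ p * fdiff h (derive1n p f) x) +
   h ^+ p * (fdiff h (derive1n p f) x - h * derive1n p.+1 f x).
  by rewrite exprSr; ring.
apply: (le_trans (ler_normD _ _)); rewrite normrM normrX.
have H3 : `|h| ^+ p * `|fdiff h (derive1n p f) x - h * derive1n p.+1 f x| <=
   B * `|h| ^+ p.+2.
  apply: le_trans (ler_wpM2l (exprn_ge0 _ (normr_ge0 h)) H2) _.
  by rewrite le_eqVlt; apply/orP; left; apply/eqP; rewrite !exprS; ring.
apply: le_trans (lerD H1 H3) _.
rewrite le_eqVlt; apply/orP; left; apply/eqP.
by rewrite (exprSr _ p.+1) -natr1; ring.
Qed.

(** Difference operators in the two variables commute by a mere computation;
    commuting derivatives are deduced from this, without any continuity of the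
    mixed derivatives. *)
Definition fdiff1 h (F : R -> R -> R) : R -> R -> R :=
  fun u t => F (u + h) t - F u t.
Definition fdiff2 h (F : R -> R -> R) : R -> R -> R :=
  fun u t => F u (t + h) - F u t.

Lemma diff12C h p q F :
  iter p (fdiff1 h) (iter q (fdiff2 h) F) = iter q (fdiff2 h) (iter p (fdiff1 h) F).
Proof.
have C1 G : fdiff1 h (fdiff2 h G) = fdiff2 h (fdiff1 h G).
  by apply/funext => u; apply/funext => t; rewrite /fdiff1 /fdiff2; ring.
have Cq G : fdiff1 h (iter q (fdiff2 h) G) = iter q (fdiff2 h) (fdiff1 h G).
  by elim: q => //= q <-; rewrite C1.
by elim: p => //= p ->; rewrite Cq.
Qed.

Lemma iter_diff1E h p F u t :
  iter p (fdiff1 h) F u t = iter p (fdiff h) (fun u => F u t) u.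
Proof. by elim: p u => //= p IHp u; rewrite /fdiff1 /fdiff !IHp. Qed.

Lemma iter_diff2E h q F u : iter q (fdiff2 h) F u = iter q (fdiff h) (F u).
Proof. by elim: q => //= q IHq; apply/funext => t; rewrite /fdiff2 /fdiff !IHq. Qed.

Lemma smooth_iter_diff1 h p q F u : (forall u, smooth q (F u)) ->
  smooth q (iter p (fdiff1 h) F u).
Proof.
move=> sF; elim: p u => [|p IHp] u; first exact: sF.
by rewrite iterS; apply: smoothB.
Qed.

Lemma derive1n_iter_diff1 h p q F u t : (forall u, smooth q (F u)) ->
  derive1n q (iter p (fdiff1 h) F u) t =
  iter p (fdiff h) (fun u => derive1n q (F u) t) u.
Proof.
move=> sF; elim: p u => [//|p IHp] u.
rewrite !iterS /fdiff1 derive1nB; [|exact: smooth_iter_diff1..].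
by rewrite !IHp.
Qed.

(** The q differences in t are replaced by a derivative first, at the price of
    one more derivative in t, and then the p differences in u. *)
Lemma mixed_diff_approx (F : R -> R -> R) p q B u t h :
  (forall u, smooth q.+1 (F u)) ->
  (forall t, smooth p.+1 (fun u => derive1n q (F u) t)) ->
  (forall t, smooth p (fun u => derive1n q.+1 (F u) t)) ->
  (forall u t, `|derive1n p.+1 (fun u => derive1n q (F u) t) u| <= B) ->
  (forall u t, `|derive1n p (fun u => derive1n q.+1 (F u) t) u| <= B) ->
  `|iter p (fdiff1 h) (iter q (fdiff2 h) F) u t -
     h ^+ (p + q) * derive1n p (fun u => derive1n q (F u) t) u| <=
  (p + q)%:R * B * `|h| ^+ (p + q).+1.
Proof.
move=> sF sFq sFq1 B1 B2.
have sq : forall u, smooth q (F u) by move=> v; apply: smooth_le (sF v).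
set G := iter p (fdiff1 h) F u.
have H1 : `|iter q (fdiff h) G t - h ^+ q * derive1n q G t| <=
    q%:R * (B * `|h| ^+ p) * `|h| ^+ q.+1.
  apply: iter_diff_approx; first exact: smooth_iter_diff1.
  move=> v; rewrite derive1n_iter_diff1//.
  by apply: iter_diff_le => // w; apply: B2.
have := @iter_diff_approx p h _ B u (sFq t) (fun v => B1 v t).
rewrite diff12C iter_diff2E -/G -derive1n_iter_diff1// -/G => H2.
have -> : iter q (fdiff h) G t -
   h ^+ (p + q) * derive1n p (fun u => derive1n q (F u) t) u =
  (iter q (fdiff h) G t - h ^+ q * derive1n q G t) +
   h ^+ q * (derive1n q G t - h ^+ p * derive1n p (fun u => derive1n q (F u) t) u).
  by rewrite exprD; ring.
apply: (le_trans (ler_normD _ _)); rewrite normrM normrX.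
have H3 := ler_wpM2l (exprn_ge0 q (normr_ge0 h)) H2.
apply: (le_trans (lerD H1 H3)).
rewrite le_eqVlt; apply/orP; left; apply/eqP.
by rewrite natrD exprSr (exprSr _ p) (exprSr _ (p + q)) exprD; ring.
Qed.

Lemma le_small_eq0 (a C : R) :
  (forall h, 0 < h -> a <= C * h) -> a <= 0.
Proof.
move=> aC; rewrite leNgt; apply/negP => a0.
have C1 : 0 < `|C| + 1 by rewrite ltr_wpDl.
have := aC (a / (2 * (`|C| + 1))).
rewrite divr_gt0 ?mulr_gt0// => /(_ isT); apply/negP; rewrite -ltNge.
rewrite mulrA ltr_pdivrMr ?mulr_gt0//; have := ler_norm C; nra.
Qed.

(** Partial derivatives commute as soon as all those of total order one higher
    are bounded: both orders of differentiation are then limits, as h tends to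
    0, of the same iterated difference divided by h^(p + q). *)
Lemma derive1n_comm (F : R -> R -> R) p q B u t :
  let DD p q u t := derive1n p (fun u => derive1n q (F u) t) u in
  let DD' p q u t := derive1n q (fun t => derive1n p (F ^~ t) u) t in
  (forall u, smooth q.+1 (F u)) -> (forall t, smooth p.+1 (F ^~ t)) ->
  (forall t, smooth p.+1 (fun u => derive1n q (F u) t)) ->
  (forall t, smooth p (fun u => derive1n q.+1 (F u) t)) ->
  (forall u, smooth q.+1 (fun t => derive1n p (F ^~ t) u)) ->
  (forall u, smooth q (fun t => derive1n p.+1 (F ^~ t) u)) ->
  (forall u t, `|DD p.+1 q u t| <= B) -> (forall u t, `|DD p q.+1 u t| <= B) ->
  (forall u t, `|DD' p.+1 q u t| <= B) -> (forall u t, `|DD' p q.+1 u t| <= B) ->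
  DD p q u t = DD' p q u t.
Proof.
move=> DD DD' s1 s2 s3 s4 s5 s6 B1 B2 B3 B4.
apply/eqP; rewrite -subr_eq0 -normr_le0.
apply: (@le_small_eq0 _ (2 * ((p + q)%:R * B))) => h h0.
have H1 := mixed_diff_approx u t h s1 s3 s4 B1 B2.
have H2 := @mixed_diff_approx (fun t u => F u t) q p B t u h s2 s5 s6
  (fun t u => B4 u t) (fun t u => B3 u t).
have E : iter q (fdiff1 h) (iter p (fdiff2 h) (fun t u => F u t)) t u =
         iter p (fdiff1 h) (iter q (fdiff2 h) F) u t.
  have X (G : R -> R -> R) k : iter k (fdiff2 h) (fun t u => G u t) =
      fun t u => iter k (fdiff1 h) G u t.
    by elim: k => //= k ->.
  have Y (G : R -> R -> R) k : iter k (fdiff1 h) (fun t u => G u t) =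
      fun t u => iter k (fdiff2 h) G u t.
    by elim: k => //= k ->.
  by rewrite X Y -diff12C.
rewrite E (addnC q p) -/(DD' p q u t) in H2; rewrite -/(DD p q u t) in H1.
have hk : 0 < h ^+ (p + q) by rewrite exprn_gt0.
rewrite -(ler_pM2l hk) -[X in X * `|_|]gtr0_norm// -normrM.
set S := iter p _ _ u t in H1 H2.
have -> : h ^+ (p + q) * (DD p q u t - DD' p q u t) =
  (S - h ^+ (p + q) * DD' p q u t) - (S - h ^+ (p + q) * DD p q u t) by ring.
apply: (le_trans (ler_normB _ _)); apply: (le_trans (lerD H2 H1)).
rewrite le_eqVlt; apply/orP; left; apply/eqP.
by rewrite (gtr0_norm h0) exprSr; ring.
Qed.

Lemma norm_cvg_le (u : nat -> R) a c : u N @[N --> \oo] --> a ->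
  (\forall N \near \oo, `|u N| <= c) -> `|a| <= c.
Proof.
move=> cu uc.
have cv : `|u N| @[N --> \oo] --> `|a| by apply: cvg_norm.
rewrite -(cvg_lim _ cv)//; apply: limr_le uc.
exact: cvgP cv.
Qed.

(** The difference quotients of f N approximate its derivative uniformly in N,
    and they converge; so the derivatives form a Cauchy sequence, and their
    limit is approximated by the difference quotients of g. *)
Lemma cvg_derivative (f : nat -> R -> R) (g : R -> R) B x :
  (forall N, smooth 2 (f N)) -> (forall N t, `|derive1n 2 (f N) t| <= B) ->
  (forall t, f N t @[N --> \oo] --> g t) ->
  derivable g x 1 /\ derive1 (f N) x @[N --> \oo] --> derive1 g x.
Proof.
move=> sf fB fg.
have approx N h : `|f N (h + x) - f N x - h * derive1 (f N) x| <= B * h ^+ 2.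
  by have := derivative_bound_quad x (h + x) (sf N) (fB N); rewrite addrK.
have cvq h : f N (h + x) - f N x @[N --> \oo] --> g (h + x) - g x.
  by apply: cvgB; apply: fg.
have B0 : 0 <= B by apply: le_trans (fB 0%N 0).
have cau : cvgn (fun N => derive1 (f N) x).
  apply: cauchy_cvg; apply/cauchy_exP => e e0.
  pose h := e / (4 * (B + 1)).
  have B1 : 0 < B + 1 by rewrite ltr_wpDl.
  have h0 : 0 < h by rewrite divr_gt0// mulr_gt0.
  have hB : B * h <= e / 4.
    by rewrite /h mulrA ler_pdivrMr ?mulr_gt0//; nra.
  exists ((g (h + x) - g x) / h).
  have eh : 0 < e / 4 * h by rewrite mulr_gt0// divr_gt0.
  have /cvgrPdist_lt/(_ _ eh) := cvq h.
  apply: filterS => N /= HN; rewrite /ball/=.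
  rewrite -(ltr_pM2l h0) -[X in X * `|_|]gtr0_norm// -normrM mulrBr.
  rewrite [h * (_ / h)]mulrC divfK ?gt_eqF//.
  have HA := approx N h.
  have -> : g (h + x) - g x - h * derive1 (f N) x =
    (g (h + x) - g x - (f N (h + x) - f N x)) +
    (f N (h + x) - f N x - h * derive1 (f N) x) by ring.
  apply: (le_lt_trans (ler_normD _ _)).
  apply: (lt_le_trans (ltr_leD HN HA)); rewrite expr2; nra.
pose d : R := limn (fun N => derive1 (f N) x).
have gd h : `|h| <= 1 -> `|g (h + x) - g x - h * d| <= B * h ^+ 2.
  move=> _.
  have cv : f N (h + x) - f N x - h * derive1 (f N) x @[N --> \oo] -->
     g (h + x) - g x - h * d.
    by apply: cvgB => //; apply: cvgM => //; exact: cvg_cst.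
  apply: (norm_cvg_le cv).
  by apply: nearW => N; apply: approx.
have [dg gE] : is_derive x 1 g d by apply: is_derive_quad gd.
by split => //; rewrite derive1E gE.
Qed.

End FiniteDifferences.

(** * Symmetric families of functions of finitely many reals *)

Section Families.
Variable R : realType.
Implicit Types (F G : seq R -> R) (a b t h B : R) (xs ys : seq R).
Implicit Types (L : seq (nat * R)) (p q r m : nat).

(** Functions of any number of real arguments are given on sequences. [pd p a]
    inserts a new first argument, differentiates p times in it, and sets it to
    a; p = 0 only inserts a. At a = 0 this is the operator D^p. *)
Definition pd p a F : seq R -> R := fun xs => derive1n p (fun t => F (t :: xs)) a.

Definition pds L F : seq R -> R := foldr (fun pa G => pd pa.1 pa.2 G) F L.

Definition symmetric_family F := forall xs ys, perm_eq xs ys -> F xs = F ys.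

Definition weight (alpha : seq nat) : nat := \sum_(a <- alpha) (a - 2).

(** Admissible exponents, where the number of variables and the weight are bounded
    independently: D^p uses up one variable and the weight p - 2. *)
Definition adm r m (alpha : seq nat) : bool :=
  [&& (size alpha <= r)%N, all (leq 2) alpha & (weight alpha <= m)%N].

Definition bounded_pds r m B F := forall p L xs, adm r m (p :: unzip1 L) ->
  smooth p (fun t => pds L F (t :: xs)) /\
  forall t, `|pd p t (pds L F) xs| <= B.

(** The closed form of the hypotheses on a symmetric function. The bounds
    concern derivatives of order at least 2 in each of at most r variables, with
    weight at most m; the vanishing first derivative at 0 appears as a quadratic
    bound, which passes to finite differences and hence to derivatives. *)
Record regular r m B F : Prop := Regular {
  reg_sym : symmetric_family F ;
  reg_zero : forall xs, F (0 :: xs) = F xs ;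
  reg_quad : forall t xs, `|F (t :: xs) - F xs| <= B * t ^+ 2 ;
  reg_bound : bounded_pds r m B F }.

Lemma pds_rcons L p a F : pds (rcons L (p, a)) F = pds L (pd p a F).
Proof. by elim: L => //= -[q b] L ->. Qed.

Lemma weight_cons p alpha : weight (p :: alpha) = (p - 2 + weight alpha)%N.
Proof. by rewrite /weight big_cons. Qed.

Lemma weight_rcons p alpha : weight (rcons alpha p) = (p - 2 + weight alpha)%N.
Proof. by rewrite /weight -cats1 big_cat big_seq1 addnC. Qed.

Lemma weight_perm alpha beta : perm_eq alpha beta -> weight alpha = weight beta.
Proof. by move=> ab; rewrite /weight; apply: perm_big. Qed.

Lemma sym_swap F a b xs : symmetric_family F -> F (a :: b :: xs) = F (b :: a :: xs).
Proof. by apply; apply/permEl; apply: (perm_catCA [:: a] [:: b] xs). Qed.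

Lemma pd_sym p a F : symmetric_family F -> symmetric_family (pd p a F).
Proof.
move=> sF xs ys xy; rewrite /pd; congr (derive1n p _ a); apply/funext => t.
by apply: sF; rewrite perm_cons.
Qed.

Lemma pd_swap p a F t xs : symmetric_family F ->
  pd p a F (t :: xs) = derive1n p (fun u => F (t :: u :: xs)) a.
Proof.
move=> sF; rewrite /pd; congr (derive1n p _ a); apply/funext => u.
exact: sym_swap.
Qed.

Lemma pds_sym L F : symmetric_family F -> symmetric_family (pds L F).
Proof. by move=> sF; elim: L => //= -[p a] L IH; apply: pd_sym. Qed.

Lemma reg_smooth r m B F p xs : regular r.+1 m B F -> (2 <= p <= m.+2)%N ->
  smooth p (fun t => F (t :: xs)) /\ forall t, `|pd p t F xs| <= B.
Proof.
move=> rF /andP[p2 pm]; apply: (reg_bound rF (L := [::])).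
by rewrite /adm weight_cons /weight big_nil /= p2 addn0 leq_subLR.
Qed.

Lemma reg_ge0 r m B F : regular r m B F -> 0 <= B.
Proof.
by move=> rF; have := reg_quad rF 1 [::]; rewrite expr1n mulr1; apply: le_trans.
Qed.

Lemma reg_pd1 r m B F xs : regular r m B F -> pd 1 0 F xs = 0.
Proof.
move=> rF; rewrite /pd /= derive1E.
have dF : is_derive (0 : R) 1 (fun t => F (t :: xs)) 0.
  apply: (@is_derive_quad _ _ 0 0 B 1) => // h _.
  by rewrite mulr0 subr0 addr0 (reg_zero rF); apply: reg_quad rF _ _.
exact: derive_val.
Qed.

Lemma reg_le r r' m m' B F : (r <= r')%N -> (m <= m')%N ->
  regular r' m' B F -> regular r m B F.
Proof.
move=> rr mm [sF zF qF bF]; split => // p L xs /and3P[s1 s2 s3].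
by apply: bF; rewrite /adm s2 (leq_trans s1 rr) (leq_trans s3 mm).
Qed.

Lemma iter_diff0 p h a : iter p (fdiff h) (fun=> 0 : R) a = 0.
Proof.
suff -> : iter p (fdiff h) (fun=> 0 : R) = fun=> 0 by [].
by elim: p => //= p ->; apply/funext => x; rewrite /fdiff subrr.
Qed.

(** Derivatives of a regular family are regular. The quadratic bound is the
    point: the finite differences of F in the variable of differentiation
    satisfy it, with a constant proportional to h^p, and they approximate the
    derivative as h tends to 0 as long as one unit of weight is left. *)
Lemma reg_pd r m B F p a : regular r.+2 m B F -> (2 <= p)%N -> (p - 2 < m)%N ->
  regular r.+1 (m - (p - 2)) B (pd p a F).
Proof.
move=> rF p2 pm; have [sF zF qF bF] := rF; split.
- exact: pd_sym.
- move=> xs; rewrite pd_swap//; rewrite /pd; congr (derive1n p _ a).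
  by apply/funext => t; rewrite zF.
- move=> t xs.
  (* u is the variable of differentiation, v the argument sent to 0 *)
  pose H u v := F (v :: u :: xs).
  have sH2 u : smooth 2 (H u).
    by case: (reg_smooth (p := 2) (u :: xs) rF) => //.
  have sHp v : smooth p.+1 (H ^~ v) /\ forall u, `|derive1n p.+1 (H ^~ v) u| <= B.
    have [|s1 s2] := reg_smooth (p := p.+1) (v :: xs) rF; first by lia.
    have -> : H ^~ v = fun u => F (u :: v :: xs).
      by apply/funext => u; apply: sym_swap.
    by split.
  apply/ler_addgt0Pr => e e0.
  have key h : 0 < h -> `|pd p a F (t :: xs) - pd p a F xs| - B * t ^+ 2 <=
     2 * (p%:R * B) * h.
    move=> h0; pose G := iter p (fdiff1 h) H a.
    have G1 : `|G t - G 0| <= B * `|h| ^+ p * t ^+ 2.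
      have s2G : smooth 2 G by apply: smooth_iter_diff1.
      have G2 u : `|derive1n 2 G u| <= B * `|h| ^+ p.
        rewrite derive1n_iter_diff1//.
        have A2 : adm r.+2 m (p :: unzip1 [:: (2, u)]).
          by rewrite /adm /= p2 !weight_cons /weight big_nil addn0 subnn addn0 ltnW.
        have /= [A3 A4] := bF p [:: (2, u)] xs A2.
        exact: iter_diff_le.
      have := derivative_bound_quad 0 t s2G G2.
      suff -> : derive1 G 0 = 0 by rewrite mulr0 !subr0.
      rewrite -[derive1 G 0]/(derive1n 1 G 0) (@derive1n_iter_diff1 _ h p 1)//; last first.
        by move=> u; apply: smooth_le (sH2 u).
      suff -> : (fun u => derive1n 1 (H u) 0) = (fun=> 0) by apply: iter_diff0.
      by apply/funext => u; apply: (reg_pd1 (u :: xs) rF).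
    have G3 v : `|G v - h ^+ p * pd p a F (v :: xs)| <= p%:R * B * `|h| ^+ p.+1.
      rewrite pd_swap// /G iter_diff1E.
      by apply: iter_diff_approx => [|w]; [case: (sHp v)|case: (sHp v)].
    have z : pd p a F (0 :: xs) = pd p a F xs.
      by rewrite pd_swap//; congr (derive1n p _ a); apply/funext => u; rewrite zF.
    have := G3 0; rewrite z => G30; have G3t := G3 t.
    have hp : 0 < h ^+ p by rewrite exprn_gt0.
    rewrite -(ler_pM2l hp) mulrBr -[X in X * `|_|]gtr0_norm// -normrM.
    rewrite lerBlDr.
    have -> : h ^+ p * (pd p a F (t :: xs) - pd p a F xs) =
      (G t - G 0) - (G t - h ^+ p * pd p a F (t :: xs)) +
      (G 0 - h ^+ p * pd p a F xs) by ring.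
    apply: (le_trans (ler_normD _ _)); apply: (le_trans (lerD (ler_normB _ _) G30)).
    apply: (le_trans (lerD (lerD G1 G3t) (lexx _))).
    rewrite le_eqVlt; apply/orP; left; apply/eqP.
    by rewrite (gtr0_norm h0) (exprS h p); ring.
  have := le_small_eq0 key; rewrite subr_le0 => /le_trans; apply.
  by rewrite lerDl ltW.
- move=> q L xs /and3P[s1 s2 s3].
  rewrite -pds_rcons; apply: bF; rewrite /adm.
  have -> : unzip1 (rcons L (p, a)) = rcons (unzip1 L) p by apply: map_rcons.
  move: s1 s2 s3; rewrite /= size_rcons all_rcons => s1 /andP[-> ->].
  by rewrite !weight_cons weight_rcons p2 /=; lia.
Qed.

Lemma reg_pds r m B F L : regular r m B F -> all (leq 2) (unzip1 L) ->
  (size L < r)%N -> (weight (unzip1 L) < m)%N ->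
  regular (r - size L) (m - weight (unzip1 L)) B (pds L F).
Proof.
move=> rF; elim: L => [|[p a] L IH] /=.
  by rewrite /weight big_nil !subn0.
move=> /andP[p2 L2] sL; rewrite weight_cons => wL.
have rL := IH L2 (ltnW sL) (leq_ltn_trans (leq_addl _ _) wL).
have -> : (r - (size L).+1 = (r - (size L).+2).+1)%N by lia.
have -> : (m - (p - 2 + weight (unzip1 L)) = m - weight (unzip1 L) - (p - 2))%N by lia.
apply: reg_pd => //; last by lia.
by have <- : (r - size L = (r - (size L).+2).+2)%N by lia.
Qed.

Lemma pd_comm r m B F p q a b : regular r.+2 m B F -> (2 <= p)%N -> (2 <= q)%N ->
  (p - 2 + (q - 2) < m)%N -> pd p a (pd q b F) = pd q b (pd p a F).
Proof.
move=> rF p2 q2 pq; have sF := reg_sym rF; apply/funext => xs.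
pose H u t := F (t :: u :: xs).
have E1 k c u : derive1n k (H u) c = pd k c F (u :: xs) by [].
have E2 k c t : derive1n k (H ^~ t) c = pd k c F (t :: xs).
  by rewrite pd_swap.
have S1 k u : (2 <= k <= m.+2)%N -> smooth k (H u).
  by move=> km; case: (reg_smooth (u :: xs) rF km).
have S2 k t : (2 <= k <= m.+2)%N -> smooth k (H ^~ t).
  have -> : H ^~ t = fun u => F (u :: t :: xs) by apply/funext => u; apply: sym_swap.
  by move=> km; case: (reg_smooth (t :: xs) rF km).
have S3 i k c : (2 <= i)%N -> (2 <= k)%N -> (i - 2 + (k - 2) <= m)%N ->
    smooth i (fun u => pd k c F (u :: xs)) /\
    forall u, `|derive1n i (fun u => pd k c F (u :: xs)) u| <= B.
  move=> i2 k2 ik; apply: (reg_bound rF (L := [:: (k, c)])).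
  by rewrite /adm /= !weight_cons /weight big_nil addn0 i2 k2.
have -> : pd q b (pd p a F) xs = derive1n q (fun t => derive1n p (H ^~ t) a) b.
  by rewrite {1}/pd; congr (derive1n q _ b); apply/funext => t; rewrite E2.
apply: (@derive1n_comm _ H p q B a b).
- by move=> u; apply: S1; lia.
- by move=> u; apply: S2; lia.
- by move=> t; by have [|||//] := S3 p.+1 q t; lia.
- by move=> t; by have [|||//] := S3 p q.+1 t; lia.
- move=> u; under eq_fun do rewrite E2.
  by have [|||//] := S3 q.+1 p u; lia.
- move=> u; under eq_fun do rewrite E2.
  by have [|||//] := S3 q p.+1 u; lia.
- by move=> u t; have [|||_] := S3 p.+1 q t; [lia..|apply].
- by move=> u t; have [|||_] := S3 p q.+1 t; [lia..|apply].
- move=> u t; under eq_fun do rewrite E2.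
  by have [|||_] := S3 q p.+1 u; [lia..|apply].
- move=> u t; under eq_fun do rewrite E2.
  by have [|||_] := S3 q.+1 p u; [lia..|apply].
Qed.
End Families.

Arguments pd : simpl never.

(** * Taylor expansion in an inserted argument *)

Section FamilyTaylor.
Variable R : realType.
Implicit Types (F G : seq R -> R) (a b t h B : R) (xs ys : seq R).
Implicit Types (L : seq (nat * R)) (p q r m : nat).

Lemma weight_cat alpha beta : weight (alpha ++ beta) = (weight alpha + weight beta)%N.
Proof. by rewrite /weight big_cat. Qed.

Lemma pds_move r m B F pa L1 L2 : regular r m B F ->
  all (leq 2) (unzip1 (pa :: L1 ++ L2)) -> (size (pa :: L1 ++ L2) <= r)%N ->
  (weight (unzip1 (pa :: L1 ++ L2)) < m)%N ->
  pds (pa :: L1 ++ L2) F = pds (L1 ++ pa :: L2) F.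
Proof.
move=> rF; elim: L1 => // qb L1 IH; rewrite /= !weight_cons.
move=> /and3P[p2 q2 L12] sL wL; rewrite -IH; last 3 first.
- by rewrite /= p2.
- exact: ltnW.
- by rewrite /= weight_cons; lia.
have rL : regular (r - size (L1 ++ L2)) (m - weight (unzip1 (L1 ++ L2))) B
    (pds (L1 ++ L2) F).
  by apply: reg_pds => //; lia.
move: rL.
have -> : (r - size (L1 ++ L2) = (r - (size (L1 ++ L2)).+2).+2)%N by lia.
move=> rL; apply: (pd_comm _ _ rL) => //; lia.
Qed.

(** Sorting a list of derivatives by adjacent transpositions: the weight left
    over allows each of them to commute. *)
Lemma pds_perm r m B F L L' : regular r m B F ->
  all (leq 2) (unzip1 L) -> (size L <= r)%N -> (weight (unzip1 L) < m)%N ->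
  perm_eq L L' -> pds L F = pds L' F.
Proof.
move=> rF; elim: L L' => [|pa L IH] L' aL sL wL LL'.
  by move: LL' => /perm_size/esym/size0nil ->.
have paL' : pa \in L' by rewrite -(perm_mem LL') mem_head.
case/splitPr: paL' LL' => L1 L2 LL'.
have P : perm_eq L (L1 ++ L2).
  by rewrite -(perm_cons pa); apply: (perm_trans LL'); rewrite perm_sym -cat1s perm_catCA.
have PP : perm_eq (unzip1 (pa :: L)) (unzip1 (pa :: L1 ++ L2)).
  by apply: perm_map; rewrite perm_cons.
rewrite -(pds_move rF); last 3 first.
- by rewrite -(perm_all _ PP).
- by rewrite -(perm_size (s1 := pa :: L)) ?perm_cons.
- by rewrite -(weight_perm PP).
move: aL sL wL; rewrite /= weight_cons => /andP[_ aL] sL wL.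
by rewrite (IH _ aL (ltnW sL) _ P)//; apply: leq_ltn_trans wL; apply: leq_addl.
Qed.

Lemma pds_insert L F a : symmetric_family F ->
  pds L (fun xs => F (a :: xs)) = fun xs => pds L F (a :: xs).
Proof.
move=> sF; elim: L => //= -[p b] L ->.
by apply/funext => xs; rewrite [RHS]pd_swap//; apply: pds_sym.
Qed.

Lemma reg_insert r m B F a : regular r m B F -> regular r m B (fun xs => F (a :: xs)).
Proof.
move=> [sF zF qF bF]; split.
- by move=> xs ys xy; apply: sF; rewrite perm_cons.
- by move=> xs; rewrite sym_swap// zF.
- by move=> t xs; rewrite sym_swap//; apply: qF.
- move=> p L xs A; have [s1 s2] := bF p L (a :: xs) A.
  rewrite pds_insert//.
  have E : (fun t => pds L F (a :: t :: xs)) = fun t => pds L F (t :: a :: xs).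
    by apply/funext => t; apply: sym_swap; apply: pds_sym.
  by rewrite /pd E.
Qed.

Lemma reg_insert_seq r m B F ys : regular r m B F -> regular r m B (fun xs => F (ys ++ xs)).
Proof.
elim: ys F => //= y ys IH F rF.
exact: (IH (fun xs => F (y :: xs)) (reg_insert y rF)).
Qed.

Lemma reg_taylor r m B F k t xs : regular r.+1 m B F -> (2 <= k <= m.+2)%N ->
  `|F (t :: xs) - \sum_(p < k) t ^+ p / p`!%:R * pd p 0 F xs| <= B * `|t| ^+ k.
Proof.
move=> rF km; have [sk kB] := reg_smooth xs rF km.
exact: taylor0 sk kB.
Qed.

Lemma reg_taylor1 r m B F k t xs : regular r.+1 m B F -> (1 <= k <= m.+1)%N ->
  `|pd 1 t F xs - \sum_(p < k) t ^+ p / p`!%:R * pd p.+1 0 F xs| <= B * `|t| ^+ k.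
Proof.
move=> rF km; have [sk kB] := reg_smooth (p := k.+1) xs rF km.
have /smoothS[_ s1] := sk.
have fB u : `|derive1n k (derive1 (fun t => F (t :: xs))) u| <= B.
  by rewrite -derive1Sn; apply: kB.
have := taylor0 t s1 fB.
by under eq_bigr do rewrite -derive1Sn.
Qed.

Lemma reg_continuity r m B F t u xs : regular r.+1 m B F -> `|t| <= 1 -> `|u| <= 1 ->
  `|F (t :: xs) - F (u :: xs)| <= B * `|t - u|.
Proof.
move=> rF t1 u1; have [|/smoothS[df /smoothS[ddf _]] dB] := reg_smooth (p := 2) xs rF => //.
have [v [_ v1 ->]] := MVT_between u t df.
rewrite normrM ler_wpM2r//.
have := derivative_bound_lipschitz 0 v ddf dB.
have /= := reg_pd1 xs rF; rewrite /pd /= => ->; rewrite !subr0 => /le_trans; apply.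
by rewrite ler_piMr ?(reg_ge0 rF)// (le_trans v1)// ge_max u1.
Qed.

(** Changing the argument u into v changes F by a function of t whose second
    derivative is of order |u - v| and whose first derivative vanishes at 0. *)
Lemma reg_pd1_lipschitz r m B F t u v xs : regular r.+2 m.+1 B F ->
  `|t| <= 1 -> `|u| <= 1 -> `|v| <= 1 ->
  `|pd 1 t F (u :: xs) - pd 1 t F (v :: xs)| <= B * `|u - v|.
Proof.
move=> rF t1 u1 v1.
have rF2 s : regular r.+1 m.+1 B (pd 2 s F).
  by have := reg_pd (p := 2) s rF (leqnn _) isT; rewrite subnn subn0.
have Hu w : smooth 2 (fun t => F (t :: w :: xs)).
  by case: (reg_smooth (p := 2) (w :: xs) rF).
pose f s := F (s :: u :: xs) - F (s :: v :: xs).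
have f1 s : derive1 f s = pd 1 s F (u :: xs) - pd 1 s F (v :: xs).
  rewrite -[derive1 f]/(derive1n 1 f) derive1nB//; exact: smooth_le (Hu _).
have f2 s : `|derive1n 2 f s| <= B * `|u - v|.
  by rewrite derive1nB//; apply: (reg_continuity xs (rF2 s) u1 v1).
have /smoothS[_ /smoothS[ddf _]] : smooth 2 f by apply: smoothB.
have := derivative_bound_lipschitz 0 t ddf f2.
rewrite !f1 !(reg_pd1 _ rF) !subr0 => /le_trans; apply.
by rewrite ler_piMr// mulr_ge0// (reg_ge0 rF).
Qed.

End FamilyTaylor.

(** * Logarithm and exponential of formal power series *)

Section FormalSeriesRecursions.
Variables (R : realType) (A : comAlgType R).
Implicit Types (u : nat -> A) (P Q : {poly A}) (p k m n : nat).

Lemma coef_expr_eq P Q n : (forall i, (i <= n)%N -> P`_i = Q`_i) ->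
  forall m i, (i <= n)%N -> (P ^+ m)`_i = (Q ^+ m)`_i.
Proof.
move=> PQ; elim=> [|m IH] i ni; first by rewrite !expr0.
rewrite !exprS !coefM; apply: eq_bigr => j _.
have jn : (j <= n)%N by apply: leq_trans ni; rewrite -ltnS.
by rewrite PQ// IH// (leq_trans (leq_subr _ _)).
Qed.

Lemma coef_expr_low P m i : P`_0 = 0 -> (i < m)%N -> (P ^+ m)`_i = 0.
Proof.
move=> P0; elim: m i => // m IH i im.
rewrite exprS coefM big1// => -[[|j] ji] _ /=; first by rewrite P0 mul0r.
by rewrite IH ?mulr0//; lia.
Qed.

Lemma coef_mul_expr_low P Q m i : P`_0 = 0 -> (i < m)%N -> (Q * P ^+ m)`_i = 0.
Proof.
move=> P0 im; rewrite coefM big1// => j _.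
by rewrite coef_expr_low ?mulr0// (leq_ltn_trans (leq_subr _ _)).
Qed.

(** The truncation order may be raised at will: u has no constant term, so the
    terms added to the series have valuation larger than p. *)
Lemma fps_ln1p_coef u p n : u 0%N = 0 -> (p <= n)%N ->
  fps_ln1p u p = (\sum_(1 <= m < n.+1)
    (((-1) ^+ m.-1 / m%:R)%:A : A) *: (\poly_(i < n.+1) u i) ^+ m)`_p.
Proof.
move=> u0 pn; rewrite coef_sum (@big_cat_nat _ _ _ p.+1)//=.
rewrite [X in _ + X]big_nat_cond [X in _ + X]big1 ?addr0 => [|m]; last first.
  rewrite andbT => /andP[pm _]; rewrite coefZ coef_expr_low ?mulr0//.
  by rewrite coef_poly.
rewrite /fps_ln1p; apply: eq_bigr => m _.
rewrite coefZ mulr_algl; congr (_ *: _).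
apply: (coef_expr_eq (n := p)) => // i ip.
by rewrite !coef_poly !ltnS ip (leq_trans ip pn).
Qed.

Lemma fps_exp_coef u p n : u 0%N = 0 -> (p <= n)%N ->
  fps_exp u p = (\sum_(0 <= m < n.+1)
    ((m`!%:R^-1)%:A : A) *: (\poly_(i < n.+1) u i) ^+ m)`_p.
Proof.
move=> u0 pn; rewrite coef_sum (@big_cat_nat _ _ _ p.+1)//=.
rewrite [X in _ + X]big_nat_cond [X in _ + X]big1 ?addr0 => [|m]; last first.
  rewrite andbT => /andP[pm _]; rewrite coefZ coef_expr_low ?mulr0//.
  by rewrite coef_poly.
rewrite /fps_exp; apply: eq_bigr => m _.
rewrite coefZ mulr_algl; congr (_ *: _).
apply: (coef_expr_eq (n := p)) => // i ip.
by rewrite !coef_poly !ltnS ip (leq_trans ip pn).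
Qed.

Lemma natr_inv_alg n (a : R) : ((a / n.+1%:R)%:A : A) *+ n.+1 = a%:A.
Proof. by rewrite scalerMnl -mulr_natr divfK ?pnatr_eq0. Qed.

(** Coefficient form of (1 + u) (ln (1 + u))' = u'. *)
Lemma fps_ln1p_rec u k : u 0%N = 0 ->
  u k.+1 *+ k.+1 =
  \sum_(p < k.+1) (fps_ln1p u p.+1 *+ p.+1) * (if p == k :> nat then 1 else u (k - p)%N).
Proof.
move=> u0; set n := k.+1.
pose U := \poly_(i < n.+1) u i.
pose L := \sum_(1 <= m < n.+1) (((-1) ^+ m.-1 / m%:R)%:A : A) *: U ^+ m.
have U0 : U`_0 = 0 by rewrite coef_poly.
have L' : L^`() = U^`() * \sum_(j < n) (- U) ^+ j.
  rewrite /L raddf_sum/= big_add1 big_mkord mulr_sumr; apply: eq_bigr => j _.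
  rewrite derivZ deriv_exp /= -scalerMnr scalerMnl natr_inv_alg.
  rewrite [X in _ = _ * X]exprNn mulrCA -[in RHS]signr_odd -[in LHS]signr_odd.
  by case: odd; rewrite ?expr0 ?expr1 ?scaleN1r ?scale1r ?mul1r ?scaleN1r ?mulN1r.
have geom : (1 + U) * \sum_(j < n) (- U) ^+ j = 1 - (- U) ^+ n.
  by rewrite -[1 + U]opprK opprD -[_ - U]addrC mulNr -subrX1 opprB.
have key : (1 + U) * L^`() = U^`() - (-1) ^+ n * (U^`() * U ^+ n).
  by rewrite L' mulrCA geom mulrBr mulr1 (exprNn U) mulrCA.
have := congr1 (fun P : {poly A} => P`_k) key.
rewrite coefB (exprNn 1) expr1n mulr1 -[in X in _ = _ - X]signr_odd.
have -> : ((-1) ^+ odd n * (U^`() * U ^+ n))`_k = 0.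
  case: odd; rewrite ?expr0 ?expr1 ?mul1r ?mulN1r ?coefN coef_mul_expr_low//.
  by rewrite oppr0.
rewrite subr0 coef_deriv coef_poly ltnSn => <-.
rewrite mulrC coefM; apply: eq_bigr => p _.
rewrite coef_deriv (fps_ln1p_coef (n := n))// -/U -/L; congr (_ * _).
rewrite coefD coef1 coef_poly subn_eq0.
have [pk|pk] := eqVneq (p : nat) k.
  by rewrite pk leqnn subnn u0 addr0.
have kp : (k <= p)%N = false by have := ltn_ord p; lia.
by rewrite kp add0r ltnS (leq_trans (leq_subr _ _)).
Qed.

(** Coefficient form of (exp u)' = u' exp u. *)
Lemma fps_exp_rec u k : u 0%N = 0 ->
  fps_exp u k.+1 *+ k.+1 =
  \sum_(p < k.+1) (u p.+1 *+ p.+1) * fps_exp u (k - p).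
Proof.
move=> u0; set n := k.+1.
pose U := \poly_(i < n.+1) u i.
pose E := \sum_(0 <= m < n.+1) ((m`!%:R^-1)%:A : A) *: U ^+ m.
have U0 : U`_0 = 0 by rewrite coef_poly.
have E' : E^`() = U^`() * \sum_(0 <= m < n) ((m`!%:R^-1)%:A : A) *: U ^+ m.
  rewrite /E raddf_sum/= big_nat_recl//= expr0 derivZ derivC scaler0 add0r.
  rewrite mulr_sumr; apply: eq_bigr => j _.
  rewrite derivZ deriv_exp /= -scalerMnr scalerMnl factS natrM invfM mulrC.
  by rewrite natr_inv_alg -scalerAr.
have key : E^`() = U^`() * E - ((n`!%:R^-1)%:A : A) *: (U^`() * U ^+ n).
  by rewrite E' /E [in RHS]big_nat_recr//= mulrDr -scalerAr addrK.
have := congr1 (fun P : {poly A} => P`_k) key.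
rewrite coefB coefZ coef_mul_expr_low// mulr0 subr0 coef_deriv.
rewrite -(fps_exp_coef (n := n))// => ->.
rewrite coefM; apply: eq_bigr => p _; rewrite coef_deriv coef_poly ltnS.
rewrite -(fps_exp_coef (n := n))//; last by rewrite (leq_trans (leq_subr _ _)).
by rewrite ltn_ord.
Qed.

Lemma fps_exp0 u : fps_exp u 0 = 1.
Proof. by rewrite /fps_exp big_nat1 expr0 coefC /= invr1 scale1r. Qed.

End FormalSeriesRecursions.

(** * Cumulant operators and Edgeworth polynomials *)

Section CumulantRecursions.
Variables (R : realType) (A : comAlgType R) (d : nat -> A).
Hypotheses (d0 : d 0%N = 1) (d1 : d 1%N = 0).

Let u q : A := if (2 <= q)%N then (q`!%:R^-1 : R) *: d q else 0.
Let K p : A := (p`!%:R : R) *: fps_ln1p u p.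

Lemma scale_mul (x y : R) (P Q : A) : (x *: P) * (y *: Q) = (x * y) *: (P * Q).
Proof. by rewrite -scalerAl -scalerAr scalerA. Qed.

(** Moments in terms of cumulants. *)
Lemma cumulant_rec k : (k`!%:R^-1 : R) *: d k.+1 =
  \sum_(p < k.+1) (p`!%:R^-1 / (k - p)`!%:R : R) *: (K p.+1 * d (k - p)%N).
Proof.
have := @fps_ln1p_rec R A u k erefl.
have -> : u k.+1 *+ k.+1 = (k`!%:R^-1 : R) *: d k.+1.
  rewrite /u; case: k => [|k] /=; first by rewrite d1 scaler0.
  rewrite scalerMnl; congr (_ *: _).
  by rewrite factS natrM invfM -[LHS]mulr_natl mulrA mulfV ?mul1r// pnatr_eq0.
move=> ->; apply: eq_bigr => p _.
have -> : fps_ln1p u p.+1 *+ p.+1 = (p`!%:R^-1 : R) *: K p.+1.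
  have e : p`!%:R^-1 * p.+1`!%:R = p.+1%:R :> R.
    by rewrite factS natrM mulrC mulfK// pnatr_eq0 -lt0n fact_gt0.
  by rewrite /K scalerA e scaler_nat.
have -> : (if p == k :> nat then 1 else u (k - p)%N) =
    ((k - p)`!%:R^-1 : R) *: d (k - p)%N.
  have [->|pk] := eqVneq (p : nat) k; first by rewrite subnn d0 invr1 scale1r.
  have : (0 < k - p)%N by rewrite subn_gt0 ltn_neqAle pk -ltnS ltn_ord.
  by rewrite /u; case: (k - p)%N => [//|[|n]] _ //=; rewrite d1 scaler0.
exact: scale_mul.
Qed.

Lemma cumulant_recE k : K k.+1 = (k`!%:R : R) *: ((k`!%:R^-1 : R) *: d k.+1 -
  \sum_(p < k) (p`!%:R^-1 / (k - p)`!%:R : R) *: (K p.+1 * d (k - p)%N)).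
Proof.
have kf : k`!%:R != 0 :> R by rewrite pnatr_eq0 -lt0n fact_gt0.
rewrite cumulant_rec big_ord_recr/= [X in _ *: (X - _)]addrC addrK.
by rewrite subnn d0 invr1 !mulr1 scalerA mulfV// scale1r.
Qed.

Lemma cumulant1 : K 1 = 0.
Proof. by rewrite cumulant_recE big_ord0 subr0 d1 !scaler0. Qed.

Lemma exp_rec (x : nat -> R) (g : nat -> A) l :
  let e := fps_exp (fun j => if (1 <= j)%N then x j *: g j else 0) in
  e l.+1 = (l.+1%:R^-1 : R) *: \sum_(p < l.+1)
    (x p.+1 *+ p.+1) *: (g p.+1 * e (l - p)%N).
Proof.
move=> e; apply: (@scalerI _ _ (l.+1%:R : R)); first by rewrite pnatr_eq0.
rewrite scalerA mulfV ?pnatr_eq0// scale1r scaler_nat fps_exp_rec//.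
by apply: eq_bigr => p _ /=; rewrite -/e scalerMnl -scalerAl.
Qed.

End CumulantRecursions.

Section DifferentialPolynomials.
Variable R : realType.
Implicit Types (P Q : dpoly R) (M N : {cmonom nat}) (s : seq nat).
Implicit Types (p q k l a b c : nat).

Lemma factors_count M p : count_mem p (factors M) = M p.
Proof.
rewrite /factors count_flatten -map_comp sumnE big_map.
under eq_bigr => q _ do rewrite /= count_nseq /=.
have [pM|pM] := boolP (p \in finsupp M).
  rewrite (bigD1_seq p) ?mem_sort ?sort_uniq ?fset_uniq//= eqxx mul1n.
  by rewrite big1 ?addn0// => q /negPf ->; rewrite mul0n.
rewrite big_seq big1 => [|q]; first by rewrite fsfun_dflt.
rewrite mem_sort; have [-> |_ _] := eqVneq q p; last by rewrite mul0n.
by move=> pM'; rewrite pM' in pM.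
Qed.

Lemma factorsM M N : perm_eq (factors (mmul M N)) (factors M ++ factors N).
Proof.
by apply/allP => p _ /=; rewrite count_cat !factors_count mulcmE.
Qed.

Lemma factors1 : factors (mone : {cmonom nat}) = [::].
Proof. by rewrite /factors mdom1. Qed.

Lemma factorsU p : perm_eq (factors (ucm p)) [:: p].
Proof. by apply/allP => q _ /=; rewrite factors_count ucmE addn0. Qed.

(** The operators met below are controlled through the lists of exponents of
    their monomials. *)
Definition supported (T : seq nat -> bool) P := forall M, M \in msupp P -> T (factors M).

Lemma supported_imp (T T' : seq nat -> bool) P : (forall s, T s -> T' s) ->
  supported T P -> supported T' P.
Proof. by move=> TT' TP M /TP/TT'. Qed.

Lemma supported0 T : supported T 0.
Proof. by move=> M; rewrite msupp0. Qed.

Lemma supportedD T P Q : supported T P -> supported T Q -> supported T (P + Q).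
Proof.
by move=> TP TQ M /(fsubsetP (msuppD_le P Q)); rewrite in_fsetU => /orP[/TP|/TQ].
Qed.

Lemma supportedZ T (x : R) P : supported T P -> supported T (x *: P).
Proof. by move=> TP M /(fsubsetP (msuppZ_le x P))/TP. Qed.

Lemma supportedB T P Q : supported T P -> supported T Q -> supported T (P - Q).
Proof. by move=> TP TQ; rewrite -scaleN1r; apply: supportedD => //; apply: supportedZ. Qed.

Lemma supported_sum T I (r : seq I) (X : pred I) (f : I -> dpoly R) :
  (forall i, X i -> supported T (f i)) -> supported T (\sum_(i <- r | X i) f i).
Proof.
by move=> Tf; apply: big_ind => //; [exact: supported0|exact: supportedD].
Qed.

Lemma supportedM (T1 T2 T : seq nat -> bool) P Q :
  (forall s t, T1 s -> T2 t -> forall u, perm_eq u (s ++ t) -> T u) ->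
  supported T1 P -> supported T2 Q -> supported T (P * Q).
Proof.
move=> TT TP TQ M /msuppM_le [M1 [M2 [m1 m2 ->]]].
exact: (TT _ _ (TP _ m1) (TQ _ m2) _ (factorsM _ _)).
Qed.

Definition dshape c a b s :=
  [&& all (leq 2) s, (c <= size s <= b)%N & (weight s <= a)%N].

Lemma shapeM c a b c' a' b' P Q :
  supported (dshape c a b) P -> supported (dshape c' a' b') Q ->
  supported (dshape (c + c') (a + a') (b + b')) (P * Q).
Proof.
apply: supportedM => s t /and3P[s1 /andP[s2 s4] s3] /and3P[t1 /andP[t2 t4] t3] u ust.
rewrite /dshape (perm_all _ ust) all_cat s1 t1 (perm_size ust) size_cat.
rewrite (weight_perm ust) weight_cat; apply/and3P; split => //.
  by apply/andP; split; apply: leq_add.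
exact: leq_add.
Qed.

Lemma shape_le c a b c' a' b' P : (c' <= c)%N -> (a <= a')%N -> (b <= b')%N ->
  supported (dshape c a b) P -> supported (dshape c' a' b') P.
Proof.
move=> cc aa bb; apply: supported_imp => s /and3P[s1 s2 s3].
by rewrite /dshape s1; lia.
Qed.

Lemma supported1 (T : seq nat -> bool) : T [::] -> supported T 1.
Proof.
move=> T0 M; rewrite -mcoeff_neq0 mcoeff1.
by case: (M =P mone) => [->|]; rewrite ?factors1 ?eqxx.
Qed.

Lemma shape1 : supported (dshape 0 0 0) 1.
Proof.
apply: supported1.
by rewrite /dshape /weight big_nil.
Qed.

Definition homogeneous n s := all (leq 2) s && (sumn s == n).

(** A monomial of degree n with q factors, all at least 2, has weight n - 2 q;
    it has at least one factor, and no more than n - 2 unless q = 1. *)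
Lemma homogeneous_shape n P : supported (homogeneous n.+1) P ->
  supported (dshape 1 (n.+1 - 2) (maxn 1 (n.+1 - 2))) P.
Proof.
apply: supported_imp => s /andP[s2 /eqP sn]; rewrite /dshape s2 /=.
have H : (2 * size s + weight s = sumn s)%N.
  elim: s s2 {sn} => [|p s IH] /=; first by rewrite /weight big_nil.
  by move=> /andP[p2 /IH]; rewrite weight_cons; lia.
have : (0 < size s)%N by case: s sn {s2 H}.
lia.
Qed.

(** D^p with the conventions D^0 = 1 and D^1 = 0, for which inserting t is the
    exponential generating series of the D^p. *)
Definition dsym0 p : dpoly R := if p is q.+1 then (if q is 0 then 0 else dsym R p) else 1.

Lemma dsym00 : dsym0 0 = 1. Proof. by []. Qed.
Lemma dsym01 : dsym0 1 = 0. Proof. by []. Qed.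
Lemma dsym0S p : dsym0 p.+2 = dsym R p.+2. Proof. by []. Qed.

Lemma supported_dsym0 p : supported (homogeneous p) (dsym0 p).
Proof.
case: p => [|[|p]] /=.
- exact: supported1.
- exact: supported0.
- move=> M /(fsubsetP msuppU_le); rewrite inE => /eqP ->; rewrite /homogeneous.
  rewrite (perm_all _ (factorsU _)) /=; apply/eqP.
  have := factorsU p.+2; move: (factors _) => s sp.
  by rewrite (perm_small_eq _ sp)//= addn0.
Qed.

Lemma homogeneousM n n' P Q :
  supported (homogeneous n) P -> supported (homogeneous n') Q ->
  supported (homogeneous (n + n')) (P * Q).
Proof.
apply: supportedM => s t /andP[s1 /eqP s2] /andP[t1 /eqP t2] u ust.
rewrite /homogeneous (perm_all _ ust) all_cat s1 t1 /=.
by rewrite (perm_sumn ust) sumn_cat s2 t2.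
Qed.

Lemma kappaE p : kappa R p = (p`!%:R : R) *: fps_ln1p (A := dpoly R)
  (fun q => if (2 <= q)%N then (q`!%:R^-1 : R) *: dsym0 q else 0) p.
Proof.
have E : (fun q => if (2 <= q)%N then (q`!%:R^-1 : R) *: dsym R q else 0) =
         (fun q => if (2 <= q)%N then (q`!%:R^-1 : R) *: dsym0 q else 0).
  apply/funext => q; case: ltnP => [q1|_]; last reflexivity.
  case: q q1 => [q1|[q1|q q1]]; [discriminate q1|discriminate q1|reflexivity].
rewrite -E; reflexivity.
Qed.

Lemma kappa_rec k : (k`!%:R^-1 : R) *: dsym0 k.+1 =
  \sum_(p < k.+1) (p`!%:R^-1 / (k - p)`!%:R : R) *: (kappa R p.+1 * dsym0 (k - p)).
Proof.
rewrite (@cumulant_rec R (dpoly R) dsym0 erefl erefl k).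
by apply: eq_bigr => p _; rewrite kappaE; reflexivity.
Qed.

Lemma kappa1 : kappa R 1 = 0.
Proof. by rewrite kappaE (@cumulant1 R (dpoly R) dsym0 erefl erefl). Qed.

Lemma kappa_homogeneous p : supported (homogeneous p.+1) (kappa R p.+1).
Proof.
elim/ltn_ind: p => p IH.
rewrite kappaE (@cumulant_recE R (dpoly R) dsym0 erefl erefl p).
apply: supportedZ; apply: supportedB.
  by apply: supportedZ; apply: supported_dsym0.
apply: supported_sum => q _; apply: supportedZ; rewrite -kappaE.
have -> : p.+1 = (q.+1 + (p - q))%N by have := ltn_ord q; lia.
exact: (homogeneousM (IH _ (ltn_ord q)) (@supported_dsym0 _)).
Qed.

Lemma kappa_shape p : supported (dshape 1 (p.+1 - 2) (maxn 1 (p.+1 - 2))) (kappa R p.+1).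
Proof. exact/homogeneous_shape/kappa_homogeneous. Qed.

Lemma edgeworth0 tau : edgeworth tau 0 = 1 :> dpoly R.
Proof. exact: fps_exp0. Qed.

Lemma edgeworth_rec (tau : nat -> R) l : edgeworth tau l.+1 =
  (l.+1%:R^-1 : R) *: \sum_(p < l.+1) (tau p.+3 / p.+3`!%:R *+ p.+1) *:
     (kappa R p.+3 * edgeworth tau (l - p)).
Proof. exact: (@exp_rec R (dpoly R) (fun j => tau j.+2 / j.+2`!%:R) (fun j => kappa R j.+2)). Qed.

(** kappa_(j + 2) has weight at most j and, for j >= 1, at most j factors, and
    it comes with the power j of the formal variable. *)
Lemma edgeworth_shape tau l : supported (dshape 0 l l) (edgeworth tau l).
Proof.
elim/ltn_ind: l => -[_|l IH]; first by rewrite edgeworth0; apply: shape1.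
rewrite edgeworth_rec.
apply: supportedZ; apply: supported_sum => p _; apply: supportedZ.
have pl := ltn_ord p.
apply: (shape_le (c := (1 + 0)%N) (a := (p.+1 + (l - p))%N) (b := (p.+1 + (l - p))%N)); try lia.
apply: shapeM; last by apply: IH; lia.
by apply: (shape_le _ _ _ (@kappa_shape p.+2)); lia.
Qed.

End DifferentialPolynomials.

(** * Differential polynomials acting on families *)

Section LogDerivative.
Variable R : realType.

Lemma sum_triangle (f : nat -> nat -> R) J :
  \sum_(q < J) \sum_(p < J - q) f q p = \sum_(n < J) \sum_(q < n.+1) f q (n - q)%N.
Proof.
elim: J => [|J IH]; first by rewrite !big_ord0.
rewrite [RHS]big_ord_recr/= -IH big_ord_recr/= [X in _ = _ + X]big_ord_recr/=.
rewrite subnn subSnn big_ord1 addrA; congr (_ + _).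
rewrite -big_split/=; apply: eq_bigr => q _.
by rewrite subSn 1?ltnW// big_ord_recr.
Qed.

Variables (A : comAlgType R) (d K : nat -> A) (L : A -> R).
Hypothesis dK : forall k, (k`!%:R^-1 : R) *: d k.+1 =
  \sum_(p < k.+1) (p`!%:R^-1 / (k - p)`!%:R : R) *: (K p.+1 * d (k - p)%N).
Hypotheses (LD : forall x y, L (x + y) = L x + L y)
  (LZ : forall (c : R) x, L (c *: x) = c * L x).

(** The identity T' = (ln T)' T for T = sum_p t^p D^p / p!, truncated: the
    moments on the left are expressed through cumulants and moments. *)
Lemma log_derivative_expand (t : R) (P : A) J :
  \sum_(p < J) t ^+ p / p`!%:R * L (d p.+1 * P) =
  \sum_(q < J) \sum_(p < J - q) t ^+ q / q`!%:R *
       (t ^+ p / p`!%:R * L (d p * (K q.+1 * P))).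
Proof.
rewrite (sum_triangle (fun q p => t ^+ q / q`!%:R *
     (t ^+ p / p`!%:R * L (d p * (K q.+1 * P))))).
have L0 : L 0 = 0 by rewrite -(scale0r 0) LZ mul0r.
apply: eq_bigr => n _; rewrite -mulrA -LZ scalerAl dK mulr_suml.
rewrite (big_morph L LD L0) mulr_sumr; apply: eq_bigr => q _.
have -> : d (n - q)%N * (K q.+1 * P) = K q.+1 * d (n - q)%N * P.
  by rewrite mulrCA mulrA.
rewrite -scalerAl LZ.
have qn : (q <= n)%N by rewrite -ltnS.
have -> : t ^+ n = t ^+ q * t ^+ (n - q) by rewrite -exprD subnKC.
by ring.
Qed.

End LogDerivative.

Section Action.
Variable R : realType.
Implicit Types (P Q : dpoly R) (M : {cmonom nat}) (F : seq R -> R).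
Implicit Types (t B : R) (xs : seq R) (p q k l a b c r m : nat).

Definition zeros (s : seq nat) : seq (nat * R) := [seq (p, 0) | p <- s].

Lemma unzip1_zeros s : unzip1 (zeros s) = s.
Proof. by rewrite /zeros /unzip1 -map_comp map_id. Qed.

Definition mono_act F M xs : R := pds (zeros (factors M)) F xs.

(** The value at xs of the family obtained by applying P to F. *)
Definition act F xs P : R := \sum_(M <- msupp P) mcoeff M P * mono_act F M xs.

Definition dpoly_norm P : R := \sum_(M <- msupp P) `|mcoeff M P|.

Lemma dpoly_norm_ge0 P : 0 <= dpoly_norm P.
Proof. exact: sumr_ge0. Qed.

Lemma actEw F xs P (d : {fset {cmonom nat}}) : (msupp P `<=` d)%fset ->
  act F xs P = \sum_(M <- d) mcoeff M P * mono_act F M xs.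
Proof.
move=> le; rewrite /act (big_fset_incl _ le)// => M _ /mcoeff_outdom ->.
by rewrite mul0r.
Qed.

Lemma actD F xs P Q : act F xs (P + Q) = act F xs P + act F xs Q.
Proof.
pose d := (msupp P `|` msupp Q)%fset.
rewrite !(@actEw _ _ _ d) ?msuppD_le ?fsubsetUl ?fsubsetUr//.
by rewrite -big_split; apply: eq_bigr => M _; rewrite mcoeffD mulrDl.
Qed.

Lemma actZ F xs x P : act F xs (x *: P) = x * act F xs P.
Proof.
rewrite (actEw _ _ (msuppZ_le x P)) /act mulr_sumr.
by apply: eq_bigr => M _; rewrite mcoeffZ mulrA.
Qed.

Lemma act0 F xs : act F xs 0 = 0.
Proof. by rewrite -(scale0r (0 : dpoly R)) actZ mul0r. Qed.

Lemma act_sum F xs I (s : seq I) (X : pred I) (f : I -> dpoly R) :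
  act F xs (\sum_(i <- s | X i) f i) = \sum_(i <- s | X i) act F xs (f i).
Proof. exact: (big_morph (act F xs) (actD F xs) (act0 F xs)). Qed.

Lemma actU F xs x M : act F xs (mkmalgU M x) = x * mono_act F M xs.
Proof. by rewrite (actEw _ _ msuppU_le) big_seq_fset1 mcoeffUU. Qed.

Lemma act1 F xs : act F xs 1 = F xs.
Proof.
by rewrite -[1]/(mkmalgU mone 1 : dpoly R) actU mul1r /mono_act factors1.
Qed.

Lemma mono_act_regular r m B F M c a b : regular r m B F ->
  dshape c a b (factors M) -> (b < r)%N -> (a < m)%N ->
  regular (r - b) (m - a) B (mono_act F M).
Proof.
move=> rF /and3P[s1 /andP[_ s2] s3] br am.
apply: (reg_le (r' := r - size (zeros (factors M)))
  (m' := m - weight (unzip1 (zeros (factors M))))).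
- by rewrite size_map leq_sub2l.
- by rewrite unzip1_zeros leq_sub2l.
- apply: reg_pds => //; rewrite ?unzip1_zeros ?size_map//.
    exact: leq_ltn_trans br.
  exact: leq_ltn_trans am.
Qed.

Lemma mono_actM r m B F M p xs : regular r m B F ->
  all (leq 2) (factors M) -> (2 <= p)%N -> (size (factors M) < r)%N ->
  (p - 2 + weight (factors M) < m)%N ->
  mono_act F (mmul (ucm p) M) xs = pd p 0 (mono_act F M) xs.
Proof.
move=> rF aM p2 sM wM; rewrite /mono_act -[RHS]/(pds ((p, 0) :: zeros (factors M)) F xs).
have P : perm_eq (p :: factors M) (factors (mmul (ucm p) M)).
  rewrite perm_sym; apply: (perm_trans (factorsM _ _)).
  by rewrite -cat1s perm_cat2r factorsU.
rewrite -(pds_perm (L := zeros (p :: factors M)) rF)//.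
- by rewrite unzip1_zeros /= p2.
- by rewrite size_map.
- by rewrite unzip1_zeros weight_cons.
- exact: perm_map.
Qed.

Lemma act_dsym0 r m B F c a b P p xs : regular r m B F ->
  supported (dshape c a b) P -> (b < r)%N -> (a + (p - 2) < m)%N ->
  act F xs (dsym0 R p * P) = \sum_(M <- msupp P) mcoeff M P * pd p 0 (mono_act F M) xs.
Proof.
move=> rF sP br ap.
have am : (a < m)%N by apply: leq_ltn_trans ap; apply: leq_addr.
have rM M : M \in msupp P -> regular (r - b) (m - a) B (mono_act F M).
  by move=> MP; apply: mono_act_regular (sP _ MP) _ _.
case: p ap => [|[|p]] ap.
- rewrite dsym00 mul1r /act big_seq [RHS]big_seq; apply: eq_bigr => M /rM rMF.
  by rewrite /pd /= (reg_zero rMF).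
- rewrite dsym01 mul0r act0 big_seq big1// => M /rM rMF.
  by rewrite (reg_pd1 xs rMF) mulr0.
- rewrite dsym0S malgME msuppU1 big_seq_fset1 act_sum big_seq [RHS]big_seq.
  apply: eq_bigr => M MP; rewrite actU mcoeffUU mul1r.
  have /and3P[s1 /andP[_ s2] s3] := sP _ MP.
  rewrite (mono_actM _ rF)//; first exact: leq_ltn_trans br.
  by apply: leq_ltn_trans ap; rewrite addnC leq_add2r.
Qed.

Lemma act_bound r m B F a b P xs : regular r m B F ->
  supported (dshape 1 a b) P -> (b <= r)%N -> (a <= m)%N ->
  `|act F xs P| <= dpoly_norm P * B.
Proof.
move=> rF sP br am; apply: (le_trans (ler_norm_sum _ _ _)).
rewrite /dpoly_norm mulr_suml big_seq [leRHS]big_seq; apply: ler_sum => M MP.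
rewrite normrM ler_wpM2l// /mono_act.
have := sP _ MP; case: (factors M) => [|p s]; first by rewrite /dshape.
move=> /and3P[s1 /andP[_ s2] s3].
apply: (reg_bound rF (L := zeros s) _ _).2.
by rewrite unzip1_zeros /adm s1 (leq_trans s2 br) (leq_trans s3 am).
Qed.

(** The derivative, at t, in an argument inserted into the family P F. *)
Definition act1d F t xs P : R :=
  \sum_(M <- msupp P) mcoeff M P * pd 1 t (mono_act F M) xs.

Lemma act_taylor r m B F c a b P k t xs : regular r m B F ->
  supported (dshape c a b) P -> (b < r)%N -> (a < m)%N -> (0 < k)%N ->
  (a + (k - 2) <= m)%N -> `|t| <= 1 ->
  `|act F (t :: xs) P - \sum_(p < k) t ^+ p / p`!%:R * act F xs (dsym0 R p * P)| <=
  dpoly_norm P * B * `|t| ^+ k.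
Proof.
move=> rF sP br am.
wlog k2 : k / (2 <= k)%N => [H|] k0 akm t1.
  have [k2|] := leqP 2 k; first exact: H.
  case: k k0 akm => [|[|]]// _ _ _.
  have := H 2%N; rewrite addn0 => /(_ isT isT (ltnW am) t1).
  pose g p := t ^+ p / p`!%:R * act F xs (dsym0 R p * P).
  rewrite -[\sum_(p < 2) _]/(\sum_(p < 2) g p) -[\sum_(p < 1) _]/(\sum_(p < 1) g p).
  have : g 1%N = 0 by rewrite /g dsym01 mul0r act0 mulr0.
  move: g => g g1.
  rewrite !big_ord_recl !big_ord0/= /bump/= addn0 g1 !addr0 => /le_trans; apply.
  rewrite expr1 ler_wpM2l ?mulr_ge0 ?dpoly_norm_ge0 ?(reg_ge0 rF)//.
  by rewrite expr2 ler_piMr.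
have -> : act F (t :: xs) P - \sum_(p < k) t ^+ p / p`!%:R * act F xs (dsym0 R p * P) =
  \sum_(M <- msupp P) mcoeff M P * (mono_act F M (t :: xs) -
    \sum_(p < k) t ^+ p / p`!%:R * pd p 0 (mono_act F M) xs).
  under [RHS]eq_bigr do rewrite mulrBr mulr_sumr.
  rewrite sumrB exchange_big; congr (_ - _); apply: eq_bigr => p _.
  rewrite (act_dsym0 _ rF sP)//; last by have := ltn_ord p; lia.
  by rewrite mulr_sumr; apply: eq_bigr => M _; rewrite mulrCA.
apply: (le_trans (ler_norm_sum _ _ _)).
rewrite /dpoly_norm -mulrA mulr_suml big_seq [leRHS]big_seq; apply: ler_sum => M MP.
rewrite normrM ler_wpM2l//.
have := mono_act_regular rF (sP _ MP) br am.
have -> : (r - b = (r - b).-1.+1)%N by lia.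
move=> rM; apply: (reg_taylor t xs rM); lia.
Qed.

Lemma act_taylor1 r m B F c a b P k t xs : regular r m B F ->
  supported (dshape c a b) P -> (b < r)%N -> (a < m)%N -> (0 < k)%N ->
  (a + (k - 1) <= m)%N ->
  `|act1d F t xs P - \sum_(p < k) t ^+ p / p`!%:R * act F xs (dsym0 R p.+1 * P)| <=
  dpoly_norm P * B * `|t| ^+ k.
Proof.
move=> rF sP br am k0 akm.
have -> : act1d F t xs P - \sum_(p < k) t ^+ p / p`!%:R * act F xs (dsym0 R p.+1 * P) =
  \sum_(M <- msupp P) mcoeff M P * (pd 1 t (mono_act F M) xs -
    \sum_(p < k) t ^+ p / p`!%:R * pd p.+1 0 (mono_act F M) xs).
  under [RHS]eq_bigr do rewrite mulrBr mulr_sumr.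
  rewrite sumrB exchange_big; congr (_ - _); apply: eq_bigr => p _.
  rewrite (act_dsym0 _ rF sP)//; last by have := ltn_ord p; lia.
  by rewrite mulr_sumr; apply: eq_bigr => M _; rewrite mulrCA.
apply: (le_trans (ler_norm_sum _ _ _)).
rewrite /dpoly_norm -mulrA mulr_suml big_seq [leRHS]big_seq; apply: ler_sum => M MP.
rewrite normrM ler_wpM2l//.
have := mono_act_regular rF (sP _ MP) br am.
have -> : (r - b = (r - b).-1.+1)%N by lia.
move=> rM; apply: (reg_taylor1 t xs rM); lia.
Qed.

(** Inserting t acts as the exponential of the sum of the t^p kappa_p / p!, so
    its derivative in t is the sum of the t^(p-1) kappa_p / (p-1)! applied after
    the insertion. Up to the order in t allowed by the bounds, this follows by
    expanding both sides at t = 0. *)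
Lemma act_log_derivative r m c a b P j :
  supported (dshape c a b) P -> (0 < j)%N -> (a + j <= m)%N -> (b + j < r)%N ->
  exists2 C, 0 <= C & forall B F t xs, regular r m B F -> `|t| <= 1 ->
  `|act1d F t xs P -
    \sum_(q < j.+1) t ^+ q / q`!%:R * act F (t :: xs) (kappa R q.+1 * P)| <=
  C * B * `|t| ^+ j.+1.
Proof.
move=> sP j0 ajm bjr.
exists (dpoly_norm P + \sum_(q < j.+1) dpoly_norm (kappa R q.+1 * P)).
  by rewrite addr_ge0 ?dpoly_norm_ge0// sumr_ge0// => q _; apply: dpoly_norm_ge0.
move=> B F t xs rF t1.
have B0 := reg_ge0 rF.
have H1 : `|act1d F t xs P -
    \sum_(p < j.+1) t ^+ p / p`!%:R * act F xs (dsym0 R p.+1 * P)| <=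
    dpoly_norm P * B * `|t| ^+ j.+1.
  by apply: act_taylor1 rF sP _ _ _ _ => //; lia.
have H2 (q : 'I_j.+1) : `|t ^+ q / q`!%:R * act F (t :: xs) (kappa R q.+1 * P) -
    \sum_(p < j.+1 - q) t ^+ q / q`!%:R *
       (t ^+ p / p`!%:R * act F xs (dsym0 R p * (kappa R q.+1 * P)))| <=
    dpoly_norm (kappa R q.+1 * P) * B * `|t| ^+ j.+1.
  have qj := ltn_ord q.
  rewrite -mulr_sumr -mulrBr normrM.
  have sK : supported (dshape (1 + c) (q.+1 - 2 + a) (maxn 1 (q.+1 - 2) + b))
      (kappa R q.+1 * P) by apply: shapeM => //; apply: kappa_shape.
  have := act_taylor (k := j.+1 - q) (t := t) xs rF sK.
  move=> /(_ _ _ _ _ t1) H.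
  have {}H : `|act F (t :: xs) (kappa R q.+1 * P) -
     \sum_(p < j.+1 - q) t ^+ p / p`!%:R * act F xs (dsym0 R p * (kappa R q.+1 * P))| <=
     dpoly_norm (kappa R q.+1 * P) * B * `|t| ^+ (j.+1 - q) by apply: H; lia.
  have tq : `|t ^+ q / q`!%:R| <= `|t| ^+ q.
    rewrite normrM normrX ler_piMr ?exprn_ge0// normfV ger0_norm// invf_le1.
      by rewrite ler1n fact_gt0.
    by rewrite ltr0n fact_gt0.
  apply: (le_trans (ler_pM _ _ tq H)) => //.
  rewrite mulrCA -exprD subnKC// ltnW//.
have E := @log_derivative_expand R (dpoly R) (dsym0 R) (kappa R) (act F xs)
  (@kappa_rec R) (actD F xs) (actZ F xs) t P j.+1.
rewrite E in H1.
set S := \sum_(q < _) \sum_(p < _) _ in H1.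
rewrite -[X in `|X|](subrKA S).
apply: (le_trans (ler_normD _ _)); rewrite 2!mulrDl; apply: lerD => //.
rewrite mulr_suml mulr_suml -sumrB.
apply: (le_trans (ler_norm_sum _ _ _)); apply: ler_sum => q _.
by rewrite distrC.
Qed.

End Action.

(** * Rotating one vector of arguments into another *)

Section Curves.
Variable R : realType.
Implicit Types (F : seq R -> R) (t B d : R) (xs ys zs X : seq R) (r m : nat).

Definition in_unit xs := all (fun x : R => `|x| <= 1) xs.

Definition close d xs ys := all2 (fun x y : R => `|y - x| <= d) xs ys.

Lemma perm_cons_cat x xs zs : perm_eq (x :: xs ++ zs) (xs ++ x :: zs).
Proof. exact/permEl/(perm_catCA [:: x] xs zs). Qed.

Lemma pd1_lipschitz r m B F t xs ys zs d : regular r.+2 m.+1 B F -> `|t| <= 1 ->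
  in_unit xs -> in_unit ys -> close d xs ys ->
  `|pd 1 t F (ys ++ zs) - pd 1 t F (xs ++ zs)| <= (size xs)%:R * (B * d).
Proof.
move=> rF t1; have B0 := reg_ge0 rF.
have sF := pd_sym 1 t (reg_sym rF).
elim: xs ys zs => [|x xs IH] [|y ys] zs //=; first by rewrite subrr normr0 mul0r.
move=> /andP[x1 xs1] /andP[y1 ys1] /andP[xy xys].
have -> : pd 1 t F (x :: xs ++ zs) = pd 1 t F (xs ++ x :: zs).
  exact/sF/perm_cons_cat.
have E : pd 1 t F (x :: ys ++ zs) = pd 1 t F (ys ++ x :: zs).
  exact/sF/perm_cons_cat.
rewrite -[X in `|X|](subrKA (pd 1 t F (x :: ys ++ zs))).
apply: (le_trans (ler_normD _ _)).
rewrite -natr1 mulrDl mul1r addrC; apply: lerD.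
  by rewrite E; apply: IH.
apply: (le_trans (reg_pd1_lipschitz (ys ++ zs) rF t1 y1 x1)).
by rewrite ler_wpM2l.
Qed.

(** Arguments are moved one after the other, the ones already moved being
    pushed behind; X keeps the initial arguments, with respect to which all the
    partial derivatives are taken. Replacing the current arguments by X in a
    partial derivative costs another factor d. *)
Lemma family_increment r m B F xs ys zs X d : regular r.+2 m.+1 B F ->
  perm_eq X (xs ++ zs) -> in_unit xs -> in_unit ys -> close d xs ys ->
  `|F (ys ++ zs) - F (xs ++ zs) -
    \sum_(uv <- zip xs ys) (uv.2 - uv.1) * pd 1 uv.1 F (rem uv.1 X)| <=
  (size xs)%:R ^+ 2 * (B * d ^+ 2).
Proof.
move=> rF; have B0 := reg_ge0 rF; have sF := reg_sym rF.
elim: xs ys zs => [|x xs IH] [|y ys] zs //= PX.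
  by rewrite big_nil !subrr normr0 expr0n mul0r.
move=> /andP[x1 xs1] /andP[y1 ys1] /andP[xy xys].
have d0 : 0 <= d by apply: le_trans xy.
rewrite big_cons /=.
have PX' : perm_eq X (xs ++ x :: zs).
  exact: perm_trans PX (perm_cons_cat _ _ _).
have E1 : F (x :: xs ++ zs) = F (xs ++ x :: zs).
  exact/sF/perm_cons_cat.
have E2 : F (x :: ys ++ zs) = F (ys ++ x :: zs).
  exact/sF/perm_cons_cat.
have E3 : pd 1 x F (rem x X) = pd 1 x F (xs ++ zs).
  apply: (pd_sym 1 x sF); rewrite -(perm_cons x).
  apply: (perm_trans _ PX); rewrite perm_sym perm_to_rem//.
  by rewrite (perm_mem PX) mem_head.
have H1 := IH ys (x :: zs) PX' xs1 ys1 xys.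
have H2 : `|F (y :: ys ++ zs) - F (x :: ys ++ zs) - (y - x) * pd 1 x F (ys ++ zs)| <=
    B * (y - x) ^+ 2.
  have [|s2 b2] := reg_smooth (p := 2) (ys ++ zs) rF => //.
  exact: derivative_bound_quad.
have H3 := pd1_lipschitz zs rF x1 xs1 ys1 xys.
set S := \sum_(uv <- _) _ in H1 *.
rewrite E3 E1.
have -> : F (y :: ys ++ zs) - F (xs ++ x :: zs) - ((y - x) * pd 1 x F (xs ++ zs) + S) =
  (F (ys ++ x :: zs) - F (xs ++ x :: zs) - S) +
  (F (y :: ys ++ zs) - F (x :: ys ++ zs) - (y - x) * pd 1 x F (ys ++ zs)) +
  (y - x) * (pd 1 x F (ys ++ zs) - pd 1 x F (xs ++ zs)).
  by rewrite E2; ring.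
apply: (le_trans (ler_normD _ _)).
apply: (le_trans (lerD (ler_normD _ _) (lexx _))).
apply: (le_trans (lerD (lerD H1 H2) (lexx _))).
rewrite normrM.
have H4 : (y - x) ^+ 2 <= d ^+ 2.
  by rewrite -[X in X <= _]real_normK ?num_real// lerXn2r ?nnegrE.
have H5 : `|y - x| * `|pd 1 x F (ys ++ zs) - pd 1 x F (xs ++ zs)| <=
    d * ((size xs)%:R * (B * d)) by apply: ler_pM.
have H6 := ler_wpM2l B0 H4.
apply: (le_trans (lerD (lerD (lexx _) H6) H5)).
have n0 : 0 <= (size xs)%:R :> R by [].
rewrite -natr1; move: (size xs)%:R n0 => n n0.
have : 0 <= n * (B * d ^+ 2) by rewrite !mulr_ge0 ?exprn_ge0.
rewrite -subr_ge0 => h; rewrite -subr_ge0.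
have -> : (n + 1) ^+ 2 * (B * d ^+ 2) - (n ^+ 2 * (B * d ^+ 2) + B * d ^+ 2 + d * (n * (B * d))) =
  n * (B * d ^+ 2) by ring.
by rewrite -[X in 0 <= X]subr0.
Qed.

Implicit Types (ab : R * R) (pts : seq (R * R)) (u : R).

(** Each argument moves as sin u * a + cos u * b, so that the sum of the squares
    is constant if both vectors have the same norm and no common support. *)
Definition curve_pt ab u : R := sin u * ab.1 + cos u * ab.2.

Definition curve pts u : seq R := [seq curve_pt ab u | ab <- pts].

Definition axial pts := all (fun ab : R * R =>
  [&& ab.1 * ab.2 == 0, `|ab.1| <= 1 & `|ab.2| <= 1]) pts.

Lemma curve_pt_unit ab u : ab.1 * ab.2 == 0 -> `|ab.1| <= 1 -> `|ab.2| <= 1 -> `|curve_pt ab u| <= 1.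
Proof.
have hs : `|sin u| <= 1 by rewrite ler_norml sin_geN1 sin_le1.
have hc : `|cos u| <= 1 by rewrite ler_norml cos_geN1 cos_le1.
rewrite mulf_eq0 /curve_pt => /orP[/eqP->|/eqP->] a1 b1.
  by rewrite mulr0 add0r normrM mulr_ile1.
by rewrite mulr0 addr0 normrM mulr_ile1.
Qed.

Lemma curve_unit pts u : axial pts -> in_unit (curve pts u).
Proof.
move=> ax; rewrite /in_unit /curve all_map; apply: sub_all ax => ab /and3P[*].
exact: curve_pt_unit.
Qed.

Lemma sin_lipschitz u v : `|sin v - sin u| <= `|v - u|.
Proof.
have [t [_ _ ->]] := MVT_between u v (fun t => @derivable_sin R t).
rewrite normrM ler_piMl//.
by rewrite derive1E derive_val ler_norml cos_geN1 cos_le1.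
Qed.

Lemma cos_lipschitz u v : `|cos v - cos u| <= `|v - u|.
Proof.
have [t [_ _ ->]] := MVT_between u v (fun t => @derivable_cos R t).
rewrite normrM ler_piMl//.
by rewrite derive1E derive_val normrN ler_norml sin_geN1 sin_le1.
Qed.

Lemma curve_close pts u v : axial pts -> close (`|v - u|) (curve pts u) (curve pts v).
Proof.
move=> ax; rewrite /close; elim: pts ax => //= ab pts IH /andP[/and3P[ab0 a1 b1] ax].
rewrite IH// andbT /curve_pt.
move: ab0; rewrite mulf_eq0 => /orP[/eqP->|/eqP->].
  rewrite !mulr0 !add0r -mulrBl normrM.
  by apply: le_trans (ler_piMr _ b1) (cos_lipschitz _ _).
rewrite !mulr0 !addr0 -mulrBl normrM.
by apply: le_trans (ler_piMr _ a1) (sin_lipschitz _ _).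
Qed.

Lemma is_derive_curve r m B F pts u : regular r.+2 m.+1 B F -> axial pts ->
  is_derive u 1 (fun v => F (curve pts v))
   (\sum_(ab <- pts) (cos u * ab.1 - sin u * ab.2) *
      pd 1 (curve_pt ab u) F (rem (curve_pt ab u) (curve pts u))).
Proof.
move=> rF ax.
pose A ab := pd 1 (curve_pt ab u) F (rem (curve_pt ab u) (curve pts u)).
pose al := \sum_(ab <- pts) ab.1 * A ab.
pose be := \sum_(ab <- pts) ab.2 * A ab.
have -> : \sum_(ab <- pts) (cos u * ab.1 - sin u * ab.2) * A ab =
    al * cos u + be * (- sin u) + 0.
  rewrite addr0 /al /be !mulr_suml -big_split/=; apply: eq_bigr => ab _.
  by rewrite mulrBl; ring.
pose g v := F (curve pts v) - (al * sin v + be * cos v).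
have -> : (fun v => F (curve pts v)) = (fun v => (al * sin v + be * cos v) + g v).
  by apply/funext => v; rewrite /g addrC subrK.
apply: is_deriveD.
apply: (@is_derive_quad _ _ _ _ ((size pts)%:R ^+ 2 * B) 1) => // h _.
rewrite mulr0 subr0.
have := family_increment (zs := [::]) (X := curve pts u) (xs := curve pts u)
  (ys := curve pts (h + u)) (d := `|h|) rF.
rewrite !cats0 perm_refl size_map => /(_ isT (curve_unit _ ax) (curve_unit _ ax)).
have cl := curve_close u (h + u) ax; rewrite addrK in cl => /(_ cl).
rewrite real_normK ?num_real// -mulrA.
have -> : zip (curve pts u) (curve pts (h + u)) = [seq (curve_pt ab u, curve_pt ab (h + u)) | ab <- pts].
  by rewrite /curve; elim: (pts) => //= ab s ->.
rewrite big_map /=.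
suff -> : \sum_(ab <- pts) (curve_pt ab (h + u) - curve_pt ab u) * A ab =
   al * (sin (h + u) - sin u) + be * (cos (h + u) - cos u).
  have -> : g (h + u) - g u = F (curve pts (h + u)) - F (curve pts u) -
     (al * (sin (h + u) - sin u) + be * (cos (h + u) - cos u)) by rewrite /g; ring.
  by [].
rewrite /al /be !mulr_suml -big_split/=; apply: eq_bigr => ab _.
by rewrite /curve_pt; ring.
Qed.

End Curves.

(** * Exponentials with a moving exponent *)

Section ExponentialFlow.
Variables (R : realType) (A : comAlgType R) (L : A -> R).
Variables (g : nat -> A) (e : R -> nat -> A) (x dx : nat -> R -> R).
Hypotheses (LD : forall y z, L (y + z) = L y + L z)
  (LZ : forall (c : R) y, L (c *: y) = c * L y).
Hypothesis e0 : forall v, e v 0%N = 1.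
Hypothesis eS : forall v l, e v l.+1 = (l.+1%:R^-1 : R) *:
  \sum_(p < l.+1) (x p v *+ p.+1) *: (g p * e v (l - p)%N).
Hypothesis xdx : forall p (v : R), is_derive v (1 : R) (x p) (dx p v).

Lemma is_derive_seq_sum (T : eqType) (s : seq T) (f : T -> R -> R) (df : T -> R) (v : R) :
  (forall i, i \in s -> is_derive v (1 : R) (f i) (df i)) ->
  is_derive v (1 : R) (fun w => \sum_(i <- s) f i w) (\sum_(i <- s) df i).
Proof.
elim: s => [|i s IH] H.
  under eq_fun do rewrite big_nil.
  by rewrite big_nil; apply: is_derive_cst.
under eq_fun do rewrite big_cons.
rewrite big_cons; apply: is_deriveD; first by apply: H; rewrite mem_head.
by apply: IH => k ks; apply: H; rewrite in_cons ks orbT.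
Qed.

Let L0 : L 0 = 0.
Proof. by rewrite -(scale0r 0) LZ mul0r. Qed.

Lemma flow_rec v l Q : l.+1%:R * L (e v l.+1 * Q) =
  \sum_(p < l.+1) x p v * p.+1%:R * L (e v (l - p)%N * (g p * Q)).
Proof.
rewrite eS -scalerAl LZ mulrA mulfV ?pnatr_eq0// mul1r mulr_suml (big_morph L LD L0).
apply: eq_bigr => p _; rewrite -scalerAl LZ; congr (_ * L _).
  by rewrite mulr_natr.
by rewrite [RHS]mulrCA mulrA.
Qed.

(** d(exp u) = du exp u, coefficient by coefficient, when the coefficients x of
    the exponent depend on a real parameter. By induction on l: differentiating
    the recursion l e_l = sum_p p x_p e_(l-p) leads to double sums in which the
    recursion is recognized again, at the orders l - q. *)
Lemma is_derive_flow l Q (v : R) : is_derive v (1 : R) (fun w => L (e w l * Q))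
  (\sum_(p < l) dx p v * L (e v (l - p.+1)%N * (g p * Q))).
Proof.
elim/ltn_ind: l Q => -[_|l IH] Q.
  under eq_fun do rewrite e0.
  by rewrite big_ord0; apply: is_derive_cst.
have -> : (fun w => L (e w l.+1 * Q)) = (fun w => l.+1%:R^-1 *
    \sum_(p <- index_enum 'I_l.+1) (x p w * (p.+1%:R * L (e w (l - p)%N * (g p * Q))))).
  apply/funext => w; rewrite -[LHS](@mulKf _ l.+1%:R) ?pnatr_eq0//.
  rewrite flow_rec; congr (_ * _); apply: eq_bigr => p _.
  by rewrite -mulrA.
have D (p : 'I_l.+1) : is_derive v (1 : R) (fun w => L (e w (l - p)%N * (g p * Q)))
    (\sum_(q < l - p) dx q v * L (e v (l - p - q.+1)%N * (g q * (g p * Q)))).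
  by apply: IH; rewrite ltnS leq_subr.
have -> : \sum_(p < l.+1) dx p v * L (e v (l.+1 - p.+1)%N * (g p * Q)) =
  l.+1%:R^-1 * \sum_(p < l.+1) (x p v * (p.+1%:R *
     \sum_(q < l - p) dx q v * L (e v (l - p - q.+1)%N * (g q * (g p * Q)))) +
   p.+1%:R * L (e v (l - p)%N * (g p * Q)) * dx p v).
  apply: (@mulfI _ l.+1%:R); first by rewrite pnatr_eq0.
  rewrite mulrA mulfV ?pnatr_eq0// mul1r big_split /=.
  have -> : \sum_(p < l.+1) x p v * (p.+1%:R *
     \sum_(q < l - p) dx q v * L (e v (l - p - q.+1)%N * (g q * (g p * Q)))) =
     \sum_(q < l.+1) dx q v * ((l - q)%:R * L (e v (l - q)%N * (g q * Q))).
    under eq_bigr do rewrite mulrA mulr_sumr.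
    rewrite big_ord_recr /= subnn big_ord0 addr0.
    rewrite [RHS]big_ord_recr /= subnn mul0r mulr0 addr0.
    pose f p q := x p v * p.+1%:R *
      (dx q v * L (e v (l - p - q.+1)%N * (g q * (g p * Q)))).
    rewrite (sum_triangle f).
    under [RHS]eq_bigr => q _.
      have -> : (l - q)%:R * L (e v (l - q)%N * (g q * Q)) =
         \sum_(p < l - q) x p v * p.+1%:R * L (e v (l - q - p.+1)%N * (g p * (g q * Q))).
        have -> : (l - q = (l - q.+1).+1)%N by have := ltn_ord q; lia.
        by rewrite flow_rec.
      rewrite mulr_sumr.
      over.
    pose f' q p := dx q v *
      (x p v * p.+1%:R * L (e v (l - q - p.+1)%N * (g p * (g q * Q)))).
    rewrite (sum_triangle f'); apply: eq_bigr => n _.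
    rewrite (reindex_inj rev_ord_inj) /=; apply: eq_bigr => q _.
    have qn : (q <= n)%N by rewrite -ltnS.
    rewrite /f /f' subSS subKn// mulrCA; congr (_ * (_ * L (e v _ * _))); first by lia.
    by rewrite mulrCA.
  rewrite -big_split /= mulr_sumr; apply: eq_bigr => p _.
  rewrite subSS; have pl : (p <= l)%N by rewrite -ltnS.
  have -> : l.+1%:R = (l - p)%:R + p.+1%:R :> R by rewrite -natrD addnS subnK.
  by ring.
apply: is_deriveZ.
apply: is_derive_seq_sum => p _.
apply: is_deriveM.
Qed.

End ExponentialFlow.

(** * The curve from the flat vector to the given one *)

Section Expansion.
Variable R : realType.
Implicit Types (P Q : dpoly R) (F : seq R -> R) (t B u v : R) (xs e : seq R).
Implicit Types (p q k l a b c r m j N : nat).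

Lemma mono_act_sym F M : symmetric_family F -> symmetric_family (mono_act F M).
Proof. exact: pds_sym. Qed.

Lemma act_sym F P xs ys : symmetric_family F -> perm_eq xs ys -> act F xs P = act F ys P.
Proof.
by move=> sF xy; apply: eq_bigr => M _; rewrite (mono_act_sym _ sF xy).
Qed.

Lemma pds_zero F L xs : symmetric_family F -> (forall xs, F (0 :: xs) = F xs) ->
  pds L F (0 :: xs) = pds L F xs.
Proof.
move=> sF zF; elim: L xs => //= -[p a] L IH xs.
rewrite pd_swap; last exact: pds_sym.
by congr (derive1n p _ a); apply/funext => t; rewrite IH.
Qed.

Lemma act_zeros r m B F P n xs : regular r m B F -> act F (nseq n 0 ++ xs) P = act F xs P.
Proof.
move=> rF; apply: eq_bigr => M _; congr (_ * _).
elim: n => //= n <-; apply: pds_zero; [exact: reg_sym rF|exact: reg_zero rF].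
Qed.

Lemma is_derive_act r m B F c a b P pts u : regular r m B F ->
  supported (dshape c a b) P -> (b.+1 < r)%N -> (a < m)%N -> axial pts ->
  is_derive u (1 : R) (fun v => act F (curve pts v) P)
   (\sum_(ab <- pts) (cos u * ab.1 - sin u * ab.2) *
      act1d F (curve_pt ab u) (rem (curve_pt ab u) (curve pts u)) P).
Proof.
move=> rF sP br am ax.
have -> : \sum_(ab <- pts) (cos u * ab.1 - sin u * ab.2) *
      act1d F (curve_pt ab u) (rem (curve_pt ab u) (curve pts u)) P =
  \sum_(M <- msupp P) mcoeff M P * \sum_(ab <- pts) (cos u * ab.1 - sin u * ab.2) *
      pd 1 (curve_pt ab u) (mono_act F M) (rem (curve_pt ab u) (curve pts u)).
  under eq_bigr do rewrite mulr_sumr.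
  rewrite exchange_big /=; apply: eq_bigr => M _.
  by rewrite mulr_sumr; apply: eq_bigr => ab _; rewrite mulrCA.
apply: is_derive_seq_sum => M MP.
apply: is_deriveZ.
have := mono_act_regular rF (sP _ MP) (ltnW br) am.
have -> : (r - b = (r - b).-2.+2)%N by lia.
have -> : (m - a = (m - a).-1.+1)%N by lia.
by move=> rM; apply: is_derive_curve rM ax.
Qed.

Definition delta N : R := (Num.sqrt N%:R)^-1.

(** The vectors whose power sums beyond the second tend to 0; the limit
    functions are the limits along them. *)
Definition flat N : seq R := nseq N (delta N).

(** Up to zero arguments, the curve defined by these pairs leads from the flat
    vector, at u = 0, to e, at u = pi / 2. *)
Definition start_end e N : seq (R * R) := [seq (x, 0) | x <- e] ++ nseq N (0, delta N).

Definition power_sum e p : R := \sum_(x <- e) x ^+ p.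

Definition abs_power_sum e p : R := \sum_(x <- e) `|x| ^+ p.

Lemma delta_ge0 N : 0 <= delta N.
Proof. by rewrite invr_ge0 sqrtr_ge0. Qed.

Lemma delta_sqr N : (0 < N)%N -> N%:R * delta N ^+ 2 = 1.
Proof. by move=> N0; rewrite exprVn sqr_sqrtr// mulfV// pnatr_eq0 -lt0n. Qed.

Lemma delta_le1 N : (0 < N)%N -> delta N <= 1.
Proof.
move=> N0; rewrite invf_le1; last by rewrite sqrtr_gt0 ltr0n.
by rewrite -[leLHS]sqrtr1 ler_sqrt ?ler1n// ler01.
Qed.

Lemma delta_pow N p : (0 < N)%N -> N%:R * delta N ^+ p.+3 <= delta N.
Proof.
move=> N0; rewrite -addn2 addnC exprD mulrA delta_sqr// mul1r exprS.
by rewrite ler_piMr ?delta_ge0// exprn_ile1 ?delta_ge0 ?delta_le1.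
Qed.

Lemma abs_power_sum_ge0 e p : 0 <= abs_power_sum e p.
Proof. by apply: sumr_ge0 => x _; rewrite exprn_ge0. Qed.

Lemma abs_power_sum2 e : abs_power_sum e 2 = power_sum e 2.
Proof. by apply: eq_bigr => x _; rewrite real_normK// num_real. Qed.

Lemma norm_power_sum e p : `|power_sum e p| <= abs_power_sum e p.
Proof.
apply: (le_trans (ler_norm_sum _ _ _)); apply: ler_sum => x _.
by rewrite normrX.
Qed.

Lemma unit_entries e x : abs_power_sum e 2 = 1 -> x \in e -> `|x| <= 1.
Proof.
move=> e1 xe; rewrite -(@ler_pXn2r _ 2) ?nnegrE// expr1n -e1 /abs_power_sum.
by rewrite (big_rem x)//= lerDl sumr_ge0// => y _; rewrite exprn_ge0.
Qed.

Lemma abs_power_sum_le1 e p : abs_power_sum e 2 = 1 -> (2 <= p)%N -> abs_power_sum e p <= 1.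
Proof.
move=> e1 p2; rewrite -[leRHS]e1 /abs_power_sum big_seq [leRHS]big_seq; apply: ler_sum => x xe.
by apply: ler_wiXn2l => //; apply: unit_entries xe.
Qed.

(** With the weights x_i^2, of total mass 1, this compares means of powers of
    |x|; pointwise, a^k b^l <= a^(k + l) + b^(k + l). *)
Lemma abs_power_sumM e k l : abs_power_sum e 2 = 1 ->
  abs_power_sum e (k + 2) * abs_power_sum e (l + 2) <= 2 * abs_power_sum e (k + l + 2).
Proof.
move=> e1.
have -> : 2 * abs_power_sum e (k + l + 2) =
    \sum_(x <- e) \sum_(y <- e) `|x| ^+ 2 * `|y| ^+ 2 * (`|x| ^+ (k + l) + `|y| ^+ (k + l)).
  have E1 : \sum_(x <- e) \sum_(y <- e) `|x| ^+ 2 * `|y| ^+ 2 * `|x| ^+ (k + l) =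
      abs_power_sum e (k + l + 2).
    apply: eq_bigr => x _; under eq_bigr do rewrite mulrAC -exprD.
    by rewrite -mulr_sumr [X in _ * X]e1 mulr1 addnC.
  have E2 : \sum_(x <- e) \sum_(y <- e) `|x| ^+ 2 * `|y| ^+ 2 * `|y| ^+ (k + l) =
      abs_power_sum e (k + l + 2).
    rewrite exchange_big /=; apply: eq_bigr => y _.
    under eq_bigr do rewrite -mulrA -exprD.
    by rewrite -mulr_suml [X in X * _]e1 mul1r addnC.
  under [RHS]eq_bigr do (under eq_bigr do rewrite mulrDr; rewrite big_split /=).
  by rewrite big_split /= E1 E2 mulr_natl mulr2n.
rewrite /abs_power_sum mulr_suml; apply: ler_sum => x _.
rewrite mulr_sumr; apply: ler_sum => y _.
have -> : `|x| ^+ (k + 2) * `|y| ^+ (l + 2) = `|x| ^+ 2 * `|y| ^+ 2 * (`|x| ^+ k * `|y| ^+ l).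
  by rewrite !exprD; ring.
apply: ler_wpM2l; first by rewrite mulr_ge0 ?exprn_ge0.
have hx := normr_ge0 x; have hy := normr_ge0 y.
move: `|x| `|y| hx hy => a b a0 b0; have [ab|/ltW ba] := lerP a b.
  apply: (@le_trans _ _ (b ^+ (k + l))); last by rewrite lerDr exprn_ge0.
  by rewrite exprD ler_wpM2r ?exprn_ge0// lerXn2r.
apply: (@le_trans _ _ (a ^+ (k + l))); last by rewrite lerDl exprn_ge0.
by rewrite exprD ler_wpM2l ?exprn_ge0// lerXn2r.
Qed.

Lemma axial_start_end e N : (0 < N)%N -> abs_power_sum e 2 = 1 -> axial (start_end e N).
Proof.
move=> N0 e1; rewrite /axial all_cat all_map; apply/andP; split.
  by apply/allP => x xe /=; rewrite mulr0 eqxx normr0 ler01 andbT; apply: unit_entries xe.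
apply/allP => ab /nseqP[-> _] /=; rewrite mul0r eqxx normr0 ler01 /=.
by rewrite ger0_norm ?delta_ge0 ?delta_le1.
Qed.

Lemma curve_start_end0 e N : curve (start_end e N) 0 = nseq (size e) 0 ++ flat N.
Proof.
rewrite /curve /start_end map_cat -map_comp map_nseq /curve_pt /=; congr (_ ++ _).
  elim: e => //= x e ->; by rewrite sin0 mul0r mulr0 addr0.
by rewrite sin0 cos0 mul0r mul1r add0r.
Qed.

Lemma sum_start_end e N (f : R * R -> R) : \sum_(ab <- start_end e N) f ab =
  \sum_(x <- e) f (x, 0) + N%:R * f (0, delta N).
Proof.
rewrite /start_end big_cat big_map /=; congr (_ + _).
by rewrite big_nseq -[LHS]/(iter N (+%R (f (0, delta N))) 0) iter_addr_0 mulr_natl.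
Qed.

(** The power sums of the moving part sin u * e. *)
Definition scaled_sums e u p : R := sin u ^+ p * power_sum e p.

End Expansion.

(** * Expansion along the curve *)

Section MainExpansion.
Variable R : realType.
Implicit Types (P Q : dpoly R) (F : seq R -> R) (t B u v : R) (xs e : seq R).
Implicit Types (p q k l a b c r m j J N : nat).

Lemma edgeworth_eq0 (tau : nat -> R) l : (forall p, tau p.+3 = 0) ->
  edgeworth tau l.+1 = 0.
Proof.
move=> tau0; rewrite edgeworth_rec big1 ?scaler0// => p _.
by rewrite tau0 mul0r mul0rn scale0r.
Qed.

Lemma is_derive_sinX n (z : R) v : is_derive v (1 : R) (fun w => sin w ^+ n.+1 * z)
  (cos v * sin v ^+ n * (n.+1%:R * z)).
Proof.
have -> : (fun w => sin w ^+ n.+1 * z) = (z *: ((sin : R -> R) ^+ n.+1)).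
  by apply/funext => w; rewrite /GRing.scale/= fctE mulrC.
apply: is_derive_eq; rewrite /GRing.scale /=.
by rewrite -mulr_natr; ring.
Qed.

Lemma is_derive_edgeworth F ys e P l v : is_derive v (1 : R)
  (fun w => act F ys (edgeworth (scaled_sums e w) l * P))
  (\sum_(p < l) cos v * sin v ^+ p.+2 * power_sum e p.+3 / p.+2`!%:R *
     act F ys (edgeworth (scaled_sums e v) (l - p.+1) * (kappa R p.+3 * P))).
Proof.
apply: (@is_derive_flow R (dpoly R) (act F ys) (fun p => kappa R p.+3)
  (fun v => edgeworth (scaled_sums e v))
  (fun p w => scaled_sums e w p.+3 / p.+3`!%:R)
  (fun p v => cos v * sin v ^+ p.+2 * power_sum e p.+3 / p.+2`!%:R)
  (actD F ys) (actZ F ys)).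
- by move=> w; apply: edgeworth0.
- by move=> w n; apply: edgeworth_rec.
- move=> p w; rewrite /scaled_sums; under eq_fun do rewrite -mulrA.
  apply: is_derive_eq; first exact: is_derive_sinX.
  by rewrite factS natrM invfM -!mulrA (mulrCA p.+3%:R) mulVKf ?pnatr_eq0.
Qed.

(** The derivative in u of the power sum of order q + 1 along the curve, divided
    by q + 1. *)
Definition drift e N v q : R :=
  cos v * sin v ^+ q * power_sum e q.+1 - sin v * cos v ^+ q * (N%:R * delta R N ^+ q.+1).

Lemma sum_drift e N v q :
  \sum_(ab <- start_end e N) (cos v * ab.1 - sin v * ab.2) * curve_pt ab v ^+ q =
  drift e N v q.
Proof.
rewrite sum_start_end /drift /power_sum /curve_pt /= mulr_sumr; congr (_ + _).
  by apply: eq_bigr => x _; rewrite !mulr0 subr0 addr0 exprMn exprS; ring.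
by rewrite !mulr0 !add0r exprMn exprS; ring.
Qed.

(** The second power sum is constant along the curve: kappa_2 drops out, which is
    why only the power sums from the third one on enter the expansion. *)
Lemma drift1 e N v : (0 < N)%N -> abs_power_sum e 2 = 1 -> drift e N v 1 = 0.
Proof.
move=> N0 e1; rewrite /drift -abs_power_sum2 e1 delta_sqr// !expr1; ring.
Qed.

Lemma sin_norm_le1 v : `|sin v| <= 1.
Proof. by rewrite ler_norml sin_geN1 sin_le1. Qed.

Lemma cos_norm_le1 v : `|cos v| <= 1.
Proof. by rewrite ler_norml cos_geN1 cos_le1. Qed.

Lemma prod_norm_le1 (x y : R) n : `|x| <= 1 -> `|y| <= 1 -> `|x| * `|y| ^+ n <= 1.
Proof. by move=> x1 y1; apply: mulr_ile1; rewrite ?exprn_ile1. Qed.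

Lemma sum_speed_le e N v j : (0 < N)%N ->
  \sum_(ab <- start_end e N) `|cos v * ab.1 - sin v * ab.2| * `|curve_pt ab v| ^+ j.+2 <=
  abs_power_sum e j.+3 + delta R N.
Proof.
move=> N0; rewrite sum_start_end /curve_pt /=; apply: lerD.
  apply: ler_sum => x _; rewrite !mulr0 subr0 addr0 !normrM exprMn [leRHS]exprS.
  rewrite mulrACA; apply: ler_piMl; first by rewrite mulr_ge0.
  exact: prod_norm_le1 (cos_norm_le1 v) (sin_norm_le1 v).
rewrite !mulr0 !add0r normrN !normrM exprMn.
apply: le_trans (delta_pow R j N0); rewrite ler_wpM2l// [leRHS]exprS.
rewrite (ger0_norm (delta_ge0 R N)) mulrACA; apply: ler_piMl.
  by rewrite mulr_ge0 ?exprn_ge0 ?delta_ge0.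
exact: prod_norm_le1 (sin_norm_le1 v) (cos_norm_le1 v).
Qed.

(** Along the curve the family moves by the cumulant operators, each with the
    speed of its power sum. *)
Lemma curve_velocity r m c a b P J : supported (dshape c a b) P ->
  (a + J.+1 <= m)%N -> (b + J.+1 < r)%N ->
  exists2 C, 0 <= C & forall B F e N v, regular r m B F -> abs_power_sum e 2 = 1 ->
  (0 < N)%N ->
  `|\sum_(ab <- start_end e N) (cos v * ab.1 - sin v * ab.2) *
      act1d F (curve_pt ab v) (rem (curve_pt ab v) (curve (start_end e N) v)) P -
    \sum_(p < J) drift e N v p.+2 / p.+2`!%:R *
      act F (curve (start_end e N) v) (kappa R p.+3 * P)| <=
  C * B * (abs_power_sum e J.+3 + delta R N).
Proof.
move=> sP aJ bJ.
have [C C0 HC] := act_log_derivative sP (ltn0Sn J) aJ bJ.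
exists C => // B F e N v rF e1 N0.
have ax := axial_start_end N0 e1.
set pts := start_end e N; set X := curve pts v.
pose K q := act F X (kappa R q.+1 * P).
have E : \sum_(p < J) drift e N v p.+2 / p.+2`!%:R * K p.+2 =
  \sum_(ab <- pts) (cos v * ab.1 - sin v * ab.2) *
     \sum_(q < J.+2) curve_pt ab v ^+ q / q`!%:R * K q.
  under [RHS]eq_bigr do rewrite mulr_sumr.
  rewrite exchange_big /=.
  have -> : \sum_(q < J.+2) \sum_(ab <- pts) (cos v * ab.1 - sin v * ab.2) *
      (curve_pt ab v ^+ q / q`!%:R * K q) = \sum_(q < J.+2) drift e N v q / q`!%:R * K q.
    apply: eq_bigr => q _; rewrite -sum_drift -/pts -mulrA mulr_suml.
    by apply: eq_bigr => ab _; rewrite !mulrA.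
  have K0 : K 0%N = 0 by rewrite /K kappa1 mul0r act0.
  by rewrite !big_ord_recl /= K0 mulr0 add0r /bump /= drift1// mul0r mul0r add0r.
rewrite E -sumrB.
apply: (le_trans (ler_norm_sum _ _ _)).
apply: le_trans (ler_wpM2l (mulr_ge0 C0 (reg_ge0 rF)) (sum_speed_le e v J N0)).
rewrite -/pts mulr_sumr big_seq [leRHS]big_seq; apply: ler_sum => ab abp.
rewrite -mulrBr normrM mulrCA ler_wpM2l//.
have tX : curve_pt ab v \in X by apply: map_f.
have t1 : `|curve_pt ab v| <= 1.
  by have /allP/(_ _ tX) := curve_unit v ax.
have := HC B F _ (rem (curve_pt ab v) X) rF t1.
have KE q : act F (curve_pt ab v :: rem (curve_pt ab v) X) (kappa R q.+1 * P) = K q.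
  by apply: act_sym; [exact: reg_sym rF|rewrite perm_sym perm_to_rem].
by under eq_bigr do rewrite KE.
Qed.

(** The family and the truncated sum of Edgeworth terms agree at u = 0, and they
    satisfy the same differential equation in u up to errors of the announced
    size: the velocity of the family is a sum of terms kappa_p F with p >= 3,
    each of which is expanded by induction to an order lower by p - 2, and the
    coefficient in front of it is a power sum of order p. *)
Lemma curve_expansion J : forall P c a b r m, supported (dshape c a b) P ->
  (a + J.+1 <= m)%N -> (b + J.+1 < r)%N ->
  exists2 C, 0 <= C & forall B F e N u, regular r m B F -> abs_power_sum e 2 = 1 ->
  (0 < N)%N -> `|u| <= 2 ->
  `|act F (curve (start_end e N) u) P -
    \sum_(l < J.+1) act F (flat R N) (edgeworth (scaled_sums e u) l * P)| <=
  C * B * (abs_power_sum e J.+3 + delta R N).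
Proof.
elim/ltn_ind: J => J IH P c a b r m sP aJ bJ.
have sK p : supported (dshape (1 + c) (p.+1 + a) (p.+1 + b)) (kappa R p.+3 * P).
  apply: shapeM => //.
  by apply: (shape_le _ _ _ (@kappa_shape R p.+2)); lia.
have [C C0 HC] := curve_velocity sP aJ bJ.
have IHp (p : 'I_J) : exists Cp, 0 <= Cp /\ forall B F e N u,
    regular r m B F -> abs_power_sum e 2 = 1 -> (0 < N)%N -> `|u| <= 2 ->
    `|act F (curve (start_end e N) u) (kappa R p.+3 * P) -
      \sum_(l < J - p) act F (flat R N) (edgeworth (scaled_sums e u) l * (kappa R p.+3 * P))| <=
    Cp * B * (abs_power_sum e (J - p + 2) + delta R N).
  have pJ := ltn_ord p.
  have -> : (J - p = (J - p).-1.+1)%N by lia.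
  rewrite addn2.
  have [|||Cp Cp0 H] := IH (J - p).-1 _ _ _ _ _ r m (sK p); try lia.
  by exists Cp.
have {IHp}[Cp HCp] := fin_all_exists IHp.
exists (2 * (C + \sum_(p < J) (2 * Cp p + dpoly_norm (kappa R p.+3 * P)))).
  apply: mulr_ge0 => //; apply: addr_ge0 => //; apply: sumr_ge0 => p _.
  by rewrite addr_ge0 ?dpoly_norm_ge0// mulr_ge0//; case: (HCp p).
move=> B F e N u rF e1 N0 u2.
have B0 := reg_ge0 rF.
have ax := axial_start_end N0 e1.
set pts := start_end e N.
set err := abs_power_sum e J.+3 + delta R N.
have err0 : 0 <= err by rewrite addr_ge0 ?abs_power_sum_ge0 ?delta_ge0.
pose psi v := act F (curve pts v) P -
  \sum_(l <- index_enum 'I_J.+1) act F (flat R N) (edgeworth (scaled_sums e v) l * P).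
pose dpsi v := \sum_(ab <- pts) (cos v * ab.1 - sin v * ab.2) *
      act1d F (curve_pt ab v) (rem (curve_pt ab v) (curve pts v)) P -
  \sum_(l < J.+1) \sum_(p < l) cos v * sin v ^+ p.+2 * power_sum e p.+3 / p.+2`!%:R *
     act F (flat R N) (edgeworth (scaled_sums e v) (l - p.+1) * (kappa R p.+3 * P)).
have psiD v : is_derive v (1 : R) psi (dpsi v).
  apply: is_deriveB; first by apply: is_derive_act rF sP _ _ ax; lia.
  by apply: is_derive_seq_sum => l _; apply: is_derive_edgeworth.
(* at u = 0 all the power sums of the moving part vanish *)
have psi0 : psi 0 = 0.
  rewrite /psi curve_start_end0 (act_zeros _ _ _ rF) big_ord_recl edgeworth0 mul1r.
  rewrite big1 ?addr0 ?subrr// => l _; rewrite lift0 edgeworth_eq0 ?mul0r ?act0// => p.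
  by rewrite /scaled_sums sin0 expr0n /= mul0r.
have dpsi_le v : `|v| <= 2 ->
    `|dpsi v| <= (C + \sum_(p < J) (2 * Cp p + dpoly_norm (kappa R p.+3 * P))) * B * err.
  move=> v2; set K := fun p : nat => act F (curve pts v) (kappa R p.+3 * P).
  set S := fun p : nat => \sum_(l < J - p) act F (flat R N)
     (edgeworth (scaled_sums e v) l * (kappa R p.+3 * P)).
  pose w p := cos v * sin v ^+ p.+2 * power_sum e p.+3 / p.+2`!%:R.
  (* w p is the speed of the coefficient of kappa_(p + 3) due to the part
     sin u * e; the other part is of the order of delta and goes into the error *)
  have E : dpsi v = (\sum_(ab <- pts) (cos v * ab.1 - sin v * ab.2) *
      act1d F (curve_pt ab v) (rem (curve_pt ab v) (curve pts v)) P -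
     \sum_(p < J) drift e N v p.+2 / p.+2`!%:R * K p) +
     \sum_(p < J) (w p * (K p - S p) -
       sin v * cos v ^+ p.+2 * (N%:R * delta R N ^+ p.+3) / p.+2`!%:R * K p).
    have -> : \sum_(p < J) (w p * (K p - S p) -
         sin v * cos v ^+ p.+2 * (N%:R * delta R N ^+ p.+3) / p.+2`!%:R * K p) =
       \sum_(p < J) drift e N v p.+2 / p.+2`!%:R * K p - \sum_(p < J) w p * S p.
      by rewrite -sumrB; apply: eq_bigr => p _; rewrite /drift /w; ring.
    rewrite addrA subrK; congr (_ - _).
    rewrite big_ord_recl big_ord0 add0r.
    pose f p l := w p * act F (flat R N) (edgeworth (scaled_sums e v) l * (kappa R p.+3 * P)).
    have -> : \sum_(p < J) w p * S p = \sum_(p < J) \sum_(l < J - p) f p l.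
      by apply: eq_bigr => p _; rewrite mulr_sumr.
    rewrite sum_triangle; apply: eq_bigr => n _.
    by rewrite lift0; apply: eq_bigr => p _; rewrite subSS.
  rewrite E; apply: (le_trans (ler_normD _ _)).
  rewrite 2!mulrDl; apply: lerD; first exact: HC.
  rewrite 2!mulr_suml; apply: (le_trans (ler_norm_sum _ _ _)); apply: ler_sum => p _.
  have pJ := ltn_ord p.
  have [Cp0 H] := HCp p.
  have {}H := H B F e N v rF e1 N0 v2.
  have facV n : 0 <= (n`!%:R^-1 : R) <= 1.
    by rewrite invr_ge0 ler0n invf_le1 ?ler1n ?ltr0n fact_gt0.
  have trig1 (x y z : R) n k : `|x| <= 1 -> `|y| <= 1 -> `|x * y ^+ n * z / k`!%:R| <= `|z|.
    move=> x1 y1; rewrite !normrM normrX.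
    have /andP[f0 f1] := facV k; rewrite (ger0_norm f0).
    have -> : `|x| * `|y| ^+ n * `|z| * k`!%:R^-1 = `|x| * `|y| ^+ n * k`!%:R^-1 * `|z|.
      by ring.
    apply: ler_piMl => //; apply: mulr_ile1 => //.
    exact: prod_norm_le1.
  have h1 : `|w p| <= abs_power_sum e p.+3.
    by apply: le_trans (norm_power_sum e p.+3); apply: trig1; [apply: cos_norm_le1|apply: sin_norm_le1].
  have h3 : `|sin v * cos v ^+ p.+2 * (N%:R * delta R N ^+ p.+3) / p.+2`!%:R| <= err.
    apply: (le_trans (trig1 _ _ _ _ _ (sin_norm_le1 v) (cos_norm_le1 v))).
    have d0 : 0 <= N%:R * delta R N ^+ p.+3.
      by apply: mulr_ge0 => //; apply: exprn_ge0; apply: delta_ge0.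
    rewrite ger0_norm//.
    by apply: (le_trans (delta_pow R p N0)); rewrite lerDr abs_power_sum_ge0.
  have h4 : `|K p| <= dpoly_norm (kappa R p.+3 * P) * B.
    have sK1 : supported (dshape 1 (p.+1 + a) (p.+1 + b)) (kappa R p.+3 * P).
      by apply: (shape_le _ _ _ (sK p)); clear; lia.
    have := act_bound (curve pts v) rF sK1; apply; clear -pJ aJ bJ; lia.
  have h5 : abs_power_sum e p.+3 * (abs_power_sum e (J - p + 2) + delta R N) <= 2 * err.
    rewrite mulrDr /err mulrDr; apply: lerD.
      have := abs_power_sumM p.+1 (J - p) e1.
      have -> : (p.+1 + 2 = p.+3)%N by clear; lia.
      have -> : (p.+1 + (J - p) + 2 = J.+3)%N by clear -pJ; lia.
      exact.
    rewrite mulr_natl mulr2n; apply: le_trans (_ : delta R N <= _).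
      by rewrite ler_piMl ?delta_ge0// abs_power_sum_le1.
    by rewrite lerDl delta_ge0.
  apply: (le_trans (ler_normB _ _)); rewrite 2!mulrDl; apply: lerD.
    rewrite normrM; apply: (le_trans (ler_pM _ _ h1 H)) => //.
    have -> : abs_power_sum e p.+3 * (Cp p * B * (abs_power_sum e (J - p + 2) + delta R N)) =
      Cp p * B * (abs_power_sum e p.+3 * (abs_power_sum e (J - p + 2) + delta R N)) by ring.
    apply: (le_trans (ler_wpM2l _ h5)); first by rewrite mulr_ge0.
    by rewrite le_eqVlt; apply/orP; left; apply/eqP; ring.
  rewrite normrM mulrC; exact: ler_pM.
have [t [_ tu E]] := MVT_between 0 u (fun v => @ex_derive _ _ _ _ _ _ _ (psiD v)).
have t2 : `|t| <= 2 by apply: le_trans tu _; rewrite normr0 ge_max u2 ler0n.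
move: E; rewrite psi0 !subr0 -/(psi u) => ->.
have dt := psiD t.
rewrite derive1E derive_val normrM mulrC -!mulrA; apply: ler_pM => //.
by rewrite mulrA; apply: dpsi_le.
Qed.
End MainExpansion.

(** * The limit family *)

Section Limits.
Variable R : realType.
Implicit Types (P Q : dpoly R) (F : seq R -> R) (t B u v : R) (xs e : seq R).
Implicit Types (p q k l a b c r m j J N : nat).

Lemma curve_end e N : perm_eq (curve (start_end e N) (pi / 2)) (nseq N 0 ++ e).
Proof.
have -> : curve (start_end e N) (pi / 2) = e ++ nseq N 0; last by rewrite perm_catC.
rewrite /curve /start_end map_cat -map_comp map_nseq /curve_pt /= sin_pihalf cos_pihalf.
rewrite mul0r mulr0 addr0; congr (_ ++ _).
by elim: e => //= x e ->; rewrite mul1r mul0r addr0.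
Qed.

(** The expansion at the end of the curve, u = pi / 2. *)
Lemma expansion J P c a b r m : supported (dshape c a b) P ->
  (a + J.+1 <= m)%N -> (b + J.+1 < r)%N ->
  exists2 C, 0 <= C & forall B F e N, regular r m B F -> abs_power_sum e 2 = 1 ->
  (0 < N)%N ->
  `|act F e P - \sum_(l < J.+1) act F (flat R N) (edgeworth (power_sum e) l * P)| <=
  C * B * (abs_power_sum e J.+3 + delta R N).
Proof.
move=> sP aJ bJ; have [C C0 HC] := curve_expansion sP aJ bJ.
exists C => // B F e N rF e1 N0.
have := HC B F e N (pi / 2) rF e1 N0.
have -> : scaled_sums e (pi / 2) = power_sum e.
  by apply/funext => p; rewrite /scaled_sums sin_pihalf expr1n mul1r.
rewrite (act_sym _ (reg_sym rF) (curve_end e N)) (act_zeros _ _ _ rF); apply.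
have [/andP[h0 h2] _] := @pihalf_02_cos_pihalf R.
by rewrite ger0_norm.
Qed.

Lemma flat_unit N : (0 < N)%N -> abs_power_sum (flat R N) 2 = 1.
Proof.
move=> N0; rewrite /abs_power_sum /flat big_nseq iter_addr_0.
by rewrite ger0_norm ?delta_ge0// -mulr_natl delta_sqr.
Qed.

Lemma flat_cube N : (0 < N)%N -> abs_power_sum (flat R N) 3 <= delta R N.
Proof.
move=> N0; rewrite /abs_power_sum /flat big_nseq iter_addr_0.
by rewrite ger0_norm ?delta_ge0// -mulr_natl; apply: (delta_pow R 0).
Qed.

Lemma cvg_delta : delta R N @[N --> \oo] --> 0.
Proof.
apply/cvgrPdist_le => e e0; near=> N.
have N0 : (0 < N)%N by near: N; exists 1%N.
rewrite sub0r normrN ger0_norm ?delta_ge0//.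
have H : (e ^+ 2)^-1 < N%:R by near: N; apply: nbhs_infty_gtr.
have e2 : 0 < e ^+ 2 by rewrite exprn_gt0.
have : delta R N ^+ 2 <= e ^+ 2.
  by rewrite /delta exprVn sqr_sqrtr// invf_ple ?posrE ?ltr0n// ltW.
by rewrite ler_pXn2r// nnegrE ?delta_ge0// ltW.
Unshelve. all: by end_near. Qed.

(** The expansion of order 0 compares any two flat vectors. *)
Lemma cvg_flat r m B F xs : regular r m B F -> (1 < r)%N -> (0 < m)%N ->
  cvgn (fun N => F (xs ++ flat R N)).
Proof.
move=> rF r1 m1.
have [C C0 HC] := @expansion 0 1 0 0 0 r m (@shape1 R) m1 r1.
have B0 := reg_ge0 rF.
have rG := reg_insert_seq xs rF.
have key M N : (0 < M)%N -> (0 < N)%N ->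
    `|F (xs ++ flat R M) - F (xs ++ flat R N)| <= C * B * (delta R M + delta R N).
  move=> M0 N0; have := HC B _ (flat R M) N rG (flat_unit M0) N0.
  rewrite big_ord_recl big_ord0 addr0 edgeworth0 mul1r !act1 => /le_trans; apply.
  by apply: ler_wpM2l; [rewrite mulr_ge0|rewrite lerD2r flat_cube].
apply: cauchy_cvg; apply/cauchy_exP => eps eps0.
have CB0 : 0 < C * B + 1 by rewrite ltr_wpDl// mulr_ge0.
have e2 : 0 < eps / (2 * (C * B + 1)) by rewrite divr_gt0// mulr_gt0.
have /cvgrPdist_lt/(_ _ e2) [K _ HK] := cvg_delta.
have dK N : (K <= N)%N -> (C * B + 1) * delta R N < eps / 2.
  move=> KN; have := HK N KN; rewrite /= sub0r normrN ger0_norm ?delta_ge0//.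
  by rewrite invfM mulrA ltr_pdivlMr// mulrC.
exists (F (xs ++ flat R K.+1)).
exists K.+1 => // N /= KN.
rewrite /ball /=; apply: le_lt_trans (key _ _ _ _) _ => //.
  exact: leq_ltn_trans KN.
have := dK K.+1 (leqnSn _); have := dK N (ltnW KN).
have d1 := delta_ge0 R N; have d2 := delta_ge0 R K.+1.
have CB : 0 <= C * B by rewrite mulr_ge0.
by move: (delta R N) (delta R K.+1) (C * B) d1 d2 CB {CB0 e2 HK dK key HC} => x y z; nra.
Qed.

Definition limit_family F xs : R := limn (fun N => F (xs ++ flat R N)).

Lemma limit_family_sym F : symmetric_family F -> symmetric_family (limit_family F).
Proof.
move=> sF xs ys xy; rewrite /limit_family.
suff -> : (fun N => F (xs ++ flat R N)) = (fun N => F (ys ++ flat R N)) by [].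
by apply/funext => N; apply: sF; rewrite perm_cat2r.
Qed.

Lemma cvg_limit_family r m B F xs : regular r m B F -> (1 < r)%N -> (0 < m)%N ->
  F (xs ++ flat R N) @[N --> \oo] --> limit_family F xs.
Proof. by move=> rF r1 m1; apply: cvg_flat rF r1 m1. Qed.

(** The bound on the next derivative makes the derivatives of a given order
    converge; this is why one unit of weight is lost in the limit. *)
Lemma limit_family_pds r m B F L : regular r m B F -> (1 < r)%N ->
  adm r m.-1 (unzip1 L) -> (0 < m)%N -> forall xs,
  (if L is (p, a) :: L' then smooth p (fun t => pds L' (limit_family F) (t :: xs))
   else True) /\
  pds L F (xs ++ flat R N) @[N --> \oo] --> pds L (limit_family F) xs.
Proof.
move=> rF r1 aL m0; elim: L aL => [|[p a] L IH] aL xs.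
  by split => //; apply: cvg_limit_family rF r1 m0.
have /and3P[/= sL /andP[p2 L2] wL] := aL; rewrite weight_cons in wL.
have aL' : adm r m.-1 (unzip1 L).
  by rewrite /adm (ltnW sL) L2 (leq_trans (leq_addl _ _) wL).
pose f N t := pds L F (t :: xs ++ flat R N).
have fB q : (2 <= q <= p.+1)%N -> forall N, smooth q (f N) /\
    forall t, `|derive1n q (f N) t| <= B.
  move=> q2 N; apply: (reg_bound rF); rewrite /adm /= weight_cons sL L2.
  by clear -q2 wL m0 p2; lia.
have key q : (q <= p)%N -> smooth q (fun t => pds L (limit_family F) (t :: xs)) /\
    forall t, derive1n q (f N) t @[N --> \oo] -->
      derive1n q (fun t => pds L (limit_family F) (t :: xs)) t.
  elim: q => [|q IHq] qp.
    by split => // t; case: (IH aL' (t :: xs)).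
  have [sq cq] := IHq (ltnW qp).
  have q3 : (2 <= q.+2 <= p.+1)%N by [].
  have s2 N : smooth 2 (derive1n q (f N)).
    move=> k x k2; rewrite /derive1n -iterD; apply: (fB _ q3 N).1.
    by rewrite addnC -addn2 ltn_add2l.
  have cd t := cvg_derivative t s2 (fun N => (fB _ q3 N).2) cq.
  split; last by move=> t; case: (cd t).
  move=> k x; rewrite ltnS leq_eqVlt => /orP[/eqP kq|kq].
    rewrite kq.
    exact: (cd x).1.
  exact: (sq k x kq).
have [sp cp] := key p (leqnn p).
split; first exact: sp.
exact: (cp a).
Qed.

End Limits.

(** * Directional derivatives of functions of row vectors *)

Section RowVectors.
Variable R : realType.
Implicit Types (n p r m j : nat) (alpha : seq nat) (G : seq R -> R).

Definition coords n (x : 'rV[R]_n) : seq R := [seq x 0 i | i <- enum 'I_n].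

Definition upd n (x : 'rV[R]_n) i t : 'rV[R]_n :=
  \row_k (if k == i then t else x 0 k).

Definition allex n w (f : 'rV[R]_n -> R) := forall x, ex_deriv_word w f x.

Section Words.
Variable n : nat.
Implicit Types (f : 'rV[R]_n -> R) (x : 'rV[R]_n) (i : 'I_n) (w : seq 'I_n).

Lemma upd_upd x i s t : upd (upd x i s) i t = upd x i t.
Proof. by apply/rowP => k; rewrite !mxE; case: eqP. Qed.

Lemma upd_same x i t : upd x i t 0 i = t.
Proof. by rewrite mxE eqxx. Qed.

Lemma upd_id x i : upd x i (x 0 i) = x.
Proof. by apply/rowP => k; rewrite mxE; case: eqP => // ->. Qed.

Lemma upd_shift x i h : upd x i (h *: 1 + x 0 i) = h *: delta_mx 0 i + x.
Proof.
apply/rowP => k; rewrite !mxE eqxx /=.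
by case: eqP => [->|_]; rewrite ?mulr0 ?add0r// mulr1.
Qed.

Lemma partial_quotient f x i :
  (fun h : R => h^-1 *: ((f \o shift x) (h *: delta_mx 0 i) - f x)) =
  (fun h : R => h^-1 *: (((fun t => f (upd x i t)) \o shift (x 0 i)) (h *: 1) -
    f (upd x i (x 0 i)))).
Proof. by apply/funext => h; rewrite /= upd_shift upd_id. Qed.

Lemma derive_upd f x i :
  'D_(delta_mx 0 i) f x = derive1 (fun t => f (upd x i t)) (x 0 i).
Proof. by rewrite derive1E /derive partial_quotient. Qed.

Lemma derivable_upd f x i :
  derivable f x (delta_mx 0 i) <-> derivable (fun t => f (upd x i t)) (x 0 i) 1.
Proof. by rewrite /derivable partial_quotient. Qed.

Lemma deriv_word_cat w1 w2 f :
  deriv_word (w1 ++ w2) f = deriv_word w1 (deriv_word w2 f).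
Proof. by elim: w1 => //= i w1 ->. Qed.

Lemma allex_cons i w f : allex (i :: w) f <->
  allex w f /\ forall x, derivable (deriv_word w f) x (delta_mx 0 i).
Proof.
split=> [H|[Hw Hd] x]; last first.
  by split; [exact: (@filterE _ (nbhs x) _ _ Hw)|exact: Hd].
by split=> x; have /= [/nbhs_singleton H1 H2] := H x; [exact: H1|exact: H2].
Qed.

Lemma allex_cat w1 w2 f : allex (w1 ++ w2) f <->
  allex w2 f /\ allex w1 (deriv_word w2 f).
Proof.
elim: w1 => [|i w1 IH] /=; first by split=> [|[]//]; split.
rewrite !allex_cons deriv_word_cat; split.
  by move=> [/IH[? ?] ?].
by move=> [? [? ?]]; split => //; apply/IH.
Qed.

(** Differentiating repeatedly in the same direction only involves the
    restriction to a line. *)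
Lemma deriv_word_nseq j i f x :
  deriv_word (nseq j i) f x = derive1n j (fun t => f (upd x i t)) (x 0 i).
Proof.
elim: j x => [|j IH] x /=; first by rewrite upd_id.
rewrite derive_upd; congr (derive1 _ _); apply/funext => t.
by rewrite IH upd_same; under eq_fun do rewrite upd_upd.
Qed.

Lemma allex_nseq j i f : allex (nseq j i) f <->
  forall x, smooth j (fun t => f (upd x i t)).
Proof.
have E k x t : deriv_word (nseq k i) f (upd x i t) =
    derive1n k (fun t => f (upd x i t)) t.
  by rewrite deriv_word_nseq upd_same; under eq_fun do rewrite upd_upd.
elim: j => [|j IH]; first by split.
rewrite [nseq _ _]/= allex_cons; split=> [[/IH sj dj] x q t|sj].
  rewrite ltnS leq_eqVlt => /orP[/eqP->|]; last exact: sj.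
  have /derivable_upd := dj (upd x i t); rewrite upd_same.
  by under eq_fun do rewrite upd_upd E.
split; first by apply/IH => x; apply: smooth_le (sj x).
move=> x; apply/derivable_upd; under eq_fun do rewrite E.
exact: sj.
Qed.

End Words.

Lemma adm_behead r m p alpha : adm r m (p :: alpha) -> adm r m alpha.
Proof.
rewrite /adm weight_cons => /and3P[s1 s2 s3].
have /andP[_ aL] : (2 <= p)%N && all (leq 2) alpha := s2.
by rewrite aL (ltnW s1) (leq_trans (leq_addl _ _) s3).
Qed.

(** An insertion differentiated zero times is a mere insertion, so the zero
    entries of a multi-index turn into undifferentiated arguments. *)
Lemma pds_drop0 L G xs : symmetric_family G ->
  pds L G xs = pds [seq pa <- L | pa.1 != 0%N] G
    ([seq pa.2 | pa <- L & pa.1 == 0%N] ++ xs).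
Proof.
move=> sG; elim: L xs => //= -[p a] L IH xs /=.
have sL := pds_sym [seq pa <- L | pa.1 != 0%N] sG.
case: eqVneq => [->|p0] /=.
  rewrite /pd /= IH; apply: sL; rewrite perm_sym; exact: perm_cons_cat.
rewrite /pd; congr (derive1n p _ a); apply/funext => t; rewrite IH.
apply: sL; rewrite perm_sym; exact: perm_cons_cat.
Qed.

Section Bridge.
Variables (n : nat) (G : seq R -> R).
Hypothesis sG : symmetric_family G.
Variable alpha : seq nat.
Implicit Types (x : 'rV[R]_n) (s : seq 'I_n).

Let g (x : 'rV[R]_n) : R := G (coords x).
Let word s := flatten [seq nseq (nth 0%N alpha i) i | i : 'I_n <- s].
Let pairs x s : seq (nat * R) := [seq (nth 0%N alpha i, x 0 i) | i : 'I_n <- s].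
Let rest x s : seq R := [seq x 0 k | k <- enum 'I_n & k \notin s].

Lemma pairs_rest_upd x i s t : uniq (i :: s) ->
  pds (pairs (upd x i t) s) G (rest (upd x i t) s) =
  pds (pairs x s) G (t :: rest x (i :: s)).
Proof.
move=> /andP[is_ us].
have -> : pairs (upd x i t) s = pairs x s.
  apply/eq_in_map => k ks; rewrite mxE.
  by case: eqVneq => // ki; rewrite -ki ks in is_.
apply: pds_sym => //.
have P : perm_eq [seq k <- enum 'I_n | k \notin s] (i :: [seq k <- enum 'I_n | k \notin i :: s]).
  apply: uniq_perm; first by rewrite filter_uniq ?enum_uniq.
    by rewrite /= filter_uniq ?enum_uniq// mem_filter in_cons eqxx.
  move=> k; rewrite in_cons !mem_filter in_cons -enumT mem_enum /= !andbT.
  by case: eqVneq => [->|].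
apply: (perm_trans (perm_map _ P)); rewrite /= mxE eqxx perm_cons /rest.
apply/permEl/permPl.
rewrite (_ : [seq upd x i t 0 k | k <- _] = [seq x 0 k | k <- enum 'I_n & k \notin i :: s])//.
apply/eq_in_map => k; rewrite mem_filter in_cons negb_or mxE.
by move=> /andP[/andP[/negPf-> _] _].
Qed.

Lemma deriv_word_pds s x : uniq s ->
  deriv_word (word s) g x = pds (pairs x s) G (rest x s).
Proof.
elim: s x => [|i s IH] x us.
  by rewrite /= /g /coords /rest; congr (G [seq _ | _ <- _]); rewrite filter_predT.
rewrite /word /= deriv_word_cat deriv_word_nseq -/(word s).
have us' : uniq s by case/andP: us.
rewrite /pd; congr (derive1n _ _ _); apply/funext => t.
by rewrite IH// pairs_rest_upd.
Qed.

Let block_smooth x (i : 'I_n) s := smooth (nth 0%N alpha i)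
  (fun t => pds [seq pa <- pairs x s | pa.1 != 0%N] G
     (t :: [seq pa.2 | pa <- pairs x s & pa.1 == 0%N] ++ rest x (i :: s))).

(** The derivatives in the variables of s have already been taken and are those
    of the family; what remains is smoothness in the single variable i. *)
Lemma allex_block i s : uniq (i :: s) ->
  allex (nseq (nth 0%N alpha i) i) (deriv_word (word s) g) <->
  forall x, block_smooth x i s.
Proof.
move=> us; have us' : uniq s by case/andP: us.
rewrite allex_nseq.
have E x : (fun t => deriv_word (word s) g (upd x i t)) =
    (fun t => pds [seq pa <- pairs x s | pa.1 != 0%N] G
     (t :: [seq pa.2 | pa <- pairs x s & pa.1 == 0%N] ++ rest x (i :: s))).
  apply/funext => t; rewrite deriv_word_pds// pairs_rest_upd// pds_drop0//.
  by apply: pds_sym => //; rewrite perm_sym; apply: perm_cons_cat.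
by split=> H x; have := H x; rewrite /block_smooth E.
Qed.

Lemma allex_word r m s : uniq s ->
  (forall p L xs, adm r m (p :: unzip1 L) -> smooth p (fun t => pds L G (t :: xs))) ->
  adm r m [seq a <- [seq nth 0%N alpha i | i : 'I_n <- s] | a != 0%N] ->
  allex (word s) g.
Proof.
move=> us HG; elim: s us => [|i s IH] us //= aL.
have us' : uniq s by case/andP: us.
have U x : unzip1 [seq pa <- pairs x s | pa.1 != 0%N] =
    [seq a <- [seq nth 0%N alpha i | i : 'I_n <- s] | a != 0%N].
  rewrite /pairs /unzip1 filter_map -map_comp filter_map.
  by elim: (s) => //= k s0 IHs; case: ifP => //= _; rewrite IHs.
have aL' : adm r m [seq a <- [seq nth 0%N alpha i | i : 'I_n <- s] | a != 0%N].
  by move: aL; case: ifP => // _ /adm_behead.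
apply/allex_cat; split; first exact: IH.
apply/allex_block => // x; rewrite /block_smooth.
move: aL; case: eqVneq => [->|_] /= aL; first by move=> q t.
by apply: HG; rewrite U.
Qed.

End Bridge.

End RowVectors.

(** * From functions of row vectors to families *)

Section Assembly.
Variable R : realType.

Lemma rest_enum n (x : 'rV[R]_n) :
  [seq x 0 k | k <- enum 'I_n & k \notin enum 'I_n] = [::].
Proof.
by rewrite (eq_filter (a2 := pred0)) ?filter_pred0// => k; rewrite mem_enum.
Qed.

Lemma pairs_enum n alpha (ys : seq R) k : size ys = n -> (size alpha + k = n)%N ->
  [seq (nth 0%N alpha i, (\row_(i < n) nth 0 ys i : 'rV[R]_n) 0 i) | i : 'I_n <- enum 'I_n] =
  zip (alpha ++ nseq k 0%N) ys.
Proof.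
move=> sy sk.
have sz : size (alpha ++ nseq k 0%N) = size ys by rewrite size_cat size_nseq sk sy.
have -> : [seq (nth 0%N alpha i, (\row_(i < n) nth 0 ys i : 'rV[R]_n) 0 i) | i : 'I_n <- enum 'I_n] =
   [seq (nth 0%N alpha i, nth 0 ys i) | i <- iota 0 n].
  by rewrite -val_enum_ord -[RHS]map_comp; apply: eq_map => i /=; rewrite mxE.
apply: (@eq_from_nth _ (0%N, 0)) => [|i]; rewrite size_map size_iota.
  by rewrite size_zip sz minnn sy.
move=> im; rewrite (nth_map 0%N) ?size_iota// nth_iota// add0n nth_zip//.
rewrite nth_cat; case: ltnP => // ia.
by rewrite nth_default// nth_nseq if_same.
Qed.

Lemma filter_zip alpha k (ys zs : seq R) : all (leq 2) alpha ->
  size ys = size alpha -> size zs = k ->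
  [seq pa <- zip (alpha ++ nseq k 0%N) (ys ++ zs) | pa.1 != 0%N] = zip alpha ys /\
  [seq pa.2 | pa <- zip (alpha ++ nseq k 0%N) (ys ++ zs) & pa.1 == 0%N] = zs.
Proof.
move=> aL sy <-; rewrite zip_cat ?sy// !filter_cat map_cat.
elim: alpha ys aL sy => [|p alpha IH] [|y ys] //=.
  by move=> _ _; elim: zs => //= z zs [-> ->].
case: p => [|p] //= /andP[_ aL] [sy].
by have [-> ->] := IH ys aL sy.
Qed.

Lemma row_coords n (x : 'rV[R]_n) : \row_(i < n) nth 0 (coords x) i = x.
Proof.
apply/rowP => i; rewrite mxE (nth_map i) ?size_enum_ord//.
by rewrite nth_ord_enum.
Qed.

Lemma size_coords n (x : 'rV[R]_n) : size (coords x) = n.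
Proof. by rewrite size_map size_enum_ord. Qed.

Lemma Dmulti_pds n G alpha k (ys zs : seq R) : symmetric_family G ->
  all (leq 2) alpha -> size ys = size alpha -> size zs = k -> (size alpha + k = n)%N ->
  Dmulti alpha (fun x : 'rV[R]_n => G (coords x)) (\row_i nth 0 (ys ++ zs) i) =
  pds (zip alpha ys) G zs.
Proof.
move=> sG aL sy sz sk.
rewrite /Dmulti /word_of (deriv_word_pds sG alpha _ (enum_uniq _)) rest_enum.
rewrite (pairs_enum (k := k)) ?size_cat ?sy ?sz// pds_drop0//.
by have [-> ->] := filter_zip aL sy sz; rewrite cats0.
Qed.

Lemma smooth_of_ex_Dmulti n G p alpha k (ys zs : seq R) : symmetric_family G ->
  all (leq 2) alpha -> size ys = size alpha -> size zs = k -> (size alpha + k = n)%N ->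
  (forall x, ex_Dmulti (p :: alpha) (fun x : 'rV[R]_n.+1 => G (coords x)) x) ->
  smooth p (fun t => pds (zip alpha ys) G (t :: zs)).
Proof.
move=> sG aL sy sz sk; rewrite /ex_Dmulti /word_of => ex.
have U := enum_uniq 'I_n.+1.
pose X : 'rV[R]_n.+1 := \row_i nth 0 (0 :: ys ++ zs) i.
have E' : [seq X 0 k | k <- enum 'I_n.+1 &
    k \notin ord0 :: [seq lift ord0 i | i <- enum 'I_n]] = [::].
  by rewrite -enum_ordSl rest_enum.
have E : [seq (nth 0%N (p :: alpha) i, X 0 i) | i : 'I_n.+1 <- enum 'I_n.+1] =
    zip ((p :: alpha) ++ nseq k 0%N) (0 :: ys ++ zs).
  by apply: pairs_enum; rewrite /= ?size_cat ?sy ?sz ?addSn sk.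
rewrite enum_ordSl in ex U E.
have /allex_cat[_ H] := ex.
have := (allex_block sG (p :: alpha) U).1 H X.
case: E => _ E; rewrite E' E.
by have [-> ->] := filter_zip aL sy sz; rewrite cats0.
Qed.

Lemma ex_Dmulti_of_smooth n r m G alpha x : symmetric_family G ->
  (forall p L xs, adm r m (p :: unzip1 L) -> smooth p (fun t => pds L G (t :: xs))) ->
  adm r m alpha -> (size alpha <= n)%N ->
  ex_Dmulti alpha (fun x : 'rV[R]_n => G (coords x)) x.
Proof.
move=> sG HG aL sn; apply: (allex_word sG (enum_uniq _) HG).
have -> : [seq nth 0%N alpha i | i : 'I_n <- enum 'I_n] = alpha ++ nseq (n - size alpha) 0%N.
  have -> : [seq nth 0%N alpha i | i : 'I_n <- enum 'I_n] = [seq nth 0%N alpha i | i <- iota 0 n].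
    by rewrite -val_enum_ord -[RHS]map_comp.
  apply: (@eq_from_nth _ 0%N) => [|i]; rewrite size_map size_iota.
    by rewrite size_cat size_nseq subnKC.
  move=> im; rewrite (nth_map 0%N) ?size_iota// nth_iota// add0n nth_cat.
  by case: ltnP => // ia; rewrite nth_default// nth_nseq if_same.
rewrite filter_cat (_ : [seq a <- nseq _ _ | _] = [::]) ?cats0; last first.
  by elim: (n - _)%N.
rewrite (_ : [seq a <- alpha | _] = alpha)//; apply/all_filterP.
by case/and3P: aL => _ aL _; apply: sub_all aL => -[].
Qed.

Section Family.
Variables (s : nat) (h : forall n : nat, 'rV[R]_n -> R) (B : R).
Hypothesis hs : (3 <= s)%N.
Hypothesis h_zero : forall (n : nat) (j : 'I_n.+1) (x : 'rV[R]_n), (0 < n)%N ->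
    h (insert0 j x) = h x.
Hypothesis h_flat : forall (n : nat) (j : 'I_n) (x : 'rV[R]_n), (0 < n)%N ->
    x 0 j = 0 -> is_derive x (delta_mx 0 j) (@h n) 0.
Hypothesis h_perm : forall (n : nat) (sigma : 'S_n) (x : 'rV[R]_n), (0 < n)%N ->
    h (col_perm sigma x) = h x.
Hypothesis h_bound : forall (n : nat) (alpha : seq nat) (x : 'rV[R]_n), (0 < n)%N ->
    (size alpha <= n)%N -> admissible s alpha ->
    ex_Dmulti alpha (@h n) x /\ `|Dmulti alpha (@h n) x| <= B.

(** The value on the empty sequence is the one that makes inserting a zero
    harmless there too. *)
Definition family_of xs : R :=
  if xs is [::] then @h 1%N 0 else @h (size xs) (\row_i nth 0 xs i).

Lemma family_ofE n xs : size xs = n -> (0 < n)%N ->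
  family_of xs = @h n (\row_i nth 0 xs i).
Proof. by move=> <-; case: xs. Qed.

Lemma family_of_coords n (x : 'rV[R]_n) : (0 < n)%N -> family_of (coords x) = h x.
Proof. by move=> n0; rewrite (family_ofE (size_coords x))// row_coords. Qed.

Lemma family_of_sym : symmetric_family family_of.
Proof.
move=> xs ys; case: (posnP (size ys)) => [/size0nil ->|y0 xy].
  by move=> /perm_size/size0nil ->.
have /(@tuple_permP _ _ _ (in_tuple ys))[sg E] := xy.
rewrite (family_ofE (perm_size xy))// (@family_ofE (size ys) ys)//.
rewrite -[RHS](h_perm sg)//; congr (h _); apply/rowP => i.
rewrite !mxE E (nth_map i) ?size_enum_ord// nth_ord_enum.
by rewrite (tnth_nth 0).
Qed.

Lemma family_of_zero xs : family_of (0 :: xs) = family_of xs.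
Proof.
case: (posnP (size xs)) => [/size0nil ->|x0].
  rewrite /family_of /=; congr (h _); apply/rowP => i; rewrite !mxE.
  by rewrite ord1.
rewrite (@family_ofE (size xs).+1)// (@family_ofE (size xs) xs)//.
rewrite -[RHS](h_zero ord0)//; congr (h _); apply/rowP => i; rewrite !mxE.
by case: unliftP => [j ->|->] //=; rewrite mxE.
Qed.

Lemma family_of_derive xs : derive1 (fun t => family_of (t :: xs)) 0 = 0.
Proof.
pose n := (size xs).+1; pose x : 'rV[R]_n := \row_i nth 0 (0 :: xs) i.
have x0 : x 0 ord0 = 0 by rewrite mxE.
have dx := h_flat (j := ord0) (ltn0Sn _) x0.
have := @derive_val _ _ _ _ _ _ _ dx; rewrite derive_upd x0.
suff -> : (fun t => h (upd x ord0 t)) = (fun t => family_of (t :: xs)) by [].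
apply/funext => t; rewrite (@family_ofE n)//; congr (h _); apply/rowP => i.
by rewrite !mxE; case: (unliftP ord0 i) => [j ->|->] /=.
Qed.

Lemma family_of_bounded : bounded_pds s (s - 2) B family_of.
Proof.
move=> p L xs aL; have /and3P[sL aL2 wL] := aL.
have /andP[p2 L2] : (2 <= p)%N && all (leq 2) (unzip1 L) := aL2.
pose n := (size L + size xs)%N.
have hE : (fun x : 'rV[R]_n.+1 => family_of (coords x)) = @h n.+1.
  by apply/funext => x; apply: family_of_coords.
have adL : admissible s (p :: unzip1 L) by rewrite /admissible sL aL2.
have sn : (size (p :: unzip1 L) <= n.+1)%N by rewrite /= size_map ltnS leq_addr.
have su : size (unzip2 L) = size (unzip1 L) by rewrite !size_map.
have su' : (size (unzip1 L) + size xs = n)%N by rewrite size_map.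
have ZL : zip (unzip1 L) (unzip2 L) = L by rewrite zip_unzip.
split.
  rewrite -ZL; apply: (smooth_of_ex_Dmulti (n := n) family_of_sym L2 su erefl su').
  by move=> x; rewrite hE; case: (h_bound x (ltn0Sn n) sn adL).
move=> t; have [_] := h_bound (\row_i nth 0 ((t :: unzip2 L) ++ xs) i) (ltn0Sn n) sn adL.
rewrite -hE (Dmulti_pds (k := size xs) family_of_sym) //=.
- by rewrite ZL.
- by rewrite su.
- by rewrite addSn su'.
Qed.

Lemma family_of_regular : regular s (s - 2) B family_of.
Proof.
split; [exact: family_of_sym|exact: family_of_zero| |exact: family_of_bounded].
move=> t xs.
have [|s2 b2] := @family_of_bounded 2 [::] xs.
  by rewrite /adm /= !weight_cons /weight big_nil; lia.
have : `|family_of (t :: xs) - family_of (0 :: xs) -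
    (t - 0) * derive1 (fun t => family_of (t :: xs)) 0| <= B * (t - 0) ^+ 2.
  exact: derivative_bound_quad 0 t s2 b2.
by rewrite family_of_derive mulr0 !subr0 family_of_zero.
Qed.

Lemma hinf_seqE l (x : 'rV[R]_l) k : (0 < k)%N ->
  hinf_seq h x 1 k = family_of (coords x ++ flat R k).
Proof.
move=> k0; rewrite (@family_ofE (l + k)); last 2 first.
- by rewrite size_cat size_coords size_nseq.
- by rewrite addn_gt0 k0 orbT.
rewrite /hinf_seq; congr (h _); apply/rowP => i; rewrite !mxE nth_cat size_coords.
case: splitP => j ij; rewrite ij; first by rewrite -[in LHS](row_coords x) mxE.
by rewrite addKn nth_nseq ltn_ord mxE div1r.
Qed.

Lemma cvg_hinf l (x : 'rV[R]_l) :
  hinf_seq h x 1 k @[k --> \oo] --> limit_family family_of (coords x).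
Proof.
have s1 : (1 < s)%N by lia.
have s2 : (0 < s - 2)%N by lia.
have := @cvg_limit_family _ _ _ _ _ (coords x) family_of_regular s1 s2.
apply: cvg_trans; apply: near_eq_cvg; near=> k; apply/esym/hinf_seqE.
by near: k; exists 1%N.
Unshelve. all: by end_near. Qed.

Lemma hinfE l : hinf h (l := l) = fun x => limit_family family_of (coords x).
Proof. by apply/funext => x; apply: cvg_lim => //; apply: cvg_hinf. Qed.

Lemma limit_smooth p L xs : adm s (s - 3) (p :: unzip1 L) ->
  smooth p (fun t => pds L (limit_family family_of) (t :: xs)).
Proof.
move=> aL.
have s1 : (1 < s)%N by lia.
have s2 : (0 < s - 2)%N by lia.
have s3 : (s - 3 = (s - 2).-1)%N by lia.
rewrite s3 in aL.
exact: (@limit_family_pds R s _ B family_of ((p, 0) :: L) family_of_regular s1 aL s2 xs).1.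
Qed.

Lemma ex_Dmulti_hinf l alpha x : adm s (s - 3) alpha -> (size alpha <= l)%N ->
  ex_Dmulti alpha (hinf h (l := l)) x.
Proof.
move=> aL sl; rewrite hinfE.
apply: (ex_Dmulti_of_smooth _ _ limit_smooth aL sl).
exact/limit_family_sym/family_of_sym.
Qed.

Lemma cvg_mono_act l M : dshape 0 l l (factors M) -> (l <= s - 3)%N ->
  mono_act family_of M (flat R N) @[N --> \oo] --> Dmulti (factors M) (hinf h (l := l)) 0.
Proof.
move=> /and3P[a2 /andP[_ sl] wl] ls.
set alpha := factors M in a2 sl wl *; pose k := (l - size alpha)%N.
have -> : (0 : 'rV[R]_l) = \row_i nth 0 (nseq (size alpha) 0 ++ nseq k 0) i.
  apply/rowP => i; rewrite !mxE nth_cat !nth_nseq.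
  by case: ifP; case: ifP.
rewrite hinfE (Dmulti_pds (k := k) (limit_family_sym family_of_sym)) ?size_nseq ?subnKC//.
have -> : zip alpha (nseq (size alpha) 0) = zeros R alpha.
  by rewrite /zeros; elim: (alpha) => //= p al ->.
have s1 : (1 < s)%N by lia.
have s2 : (0 < s - 2)%N by lia.
have aL : adm s (s - 2).-1 (unzip1 (zeros R alpha)).
  by rewrite unzip1_zeros /adm a2; lia.
have := (@limit_family_pds R s _ B family_of _ family_of_regular s1 aL s2 (nseq k 0)).2.
apply: cvg_trans; apply: near_eq_cvg; apply: nearW => N.
rewrite /mono_act; elim: k => //= k <-.
by rewrite pds_zero//; [apply: family_of_sym|apply: family_of_zero].
Qed.

Lemma cvg_seq_sum (T : eqType) (S : seq T) (f : T -> nat -> R) (a : T -> R) :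
  (forall i, i \in S -> f i N @[N --> \oo] --> a i) ->
  \sum_(i <- S) f i N @[N --> \oo] --> \sum_(i <- S) a i.
Proof.
elim: S => [|i S IH] H.
  rewrite big_nil; under eq_fun do rewrite big_nil.
  exact: cvg_cst.
rewrite big_cons; under eq_fun do rewrite big_cons.
apply: cvgD; first by apply: H; rewrite mem_head.
by apply: IH => k kS; apply: H; rewrite in_cons kS orbT.
Qed.

Lemma cvg_act l (P : dpoly R) : supported (dshape 0 l l) P -> (l <= s - 3)%N ->
  act family_of (flat R N) P @[N --> \oo] --> dpoly_at0 P (hinf h (l := l)).
Proof.
move=> sP ls; apply: cvg_seq_sum => M MP.
apply: cvgM; first exact: cvg_cst.
by apply: cvg_mono_act => //; apply: sP.
Qed.

Lemma power_sum_coords n (x : 'rV[R]_n) : power_sum (coords x) = psum x.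
Proof. by apply/funext => p; rewrite /power_sum big_map big_enum. Qed.

Lemma abs_power_sum_coords n (x : 'rV[R]_n) p : abs_power_sum (coords x) p = abs_psum x p.
Proof. by rewrite /abs_power_sum big_map big_enum. Qed.

Lemma pnorm_eq1 n (x : 'rV[R]_n) : pnorm x 2 = 1 -> abs_psum x 2 = 1.
Proof.
have p0 : 0 <= abs_psum x 2 by apply: sumr_ge0 => i _; rewrite exprn_ge0.
by rewrite /pnorm powR12_sqrt// => /(congr1 (fun y => y ^+ 2)); rewrite sqr_sqrtr// expr1n.
Qed.

(** In the expansion at a flat vector of length N, every term converges to the
    corresponding derivative of the limit function. *)
Lemma expansion_limit C n (x : 'rV[R]_n) : (0 < n)%N ->
  (forall N, (0 < N)%N -> `|act family_of (coords x) 1 - \sum_(l < s - 2)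
     act family_of (flat R N) (edgeworth (power_sum (coords x)) l * 1)| <=
     C * B * (abs_power_sum (coords x) s + delta R N)) ->
  `|h x - (hinf h (0 : 'rV[R]_0) +
     \sum_(1 <= l < s - 2) dpoly_at0 (edgeworth (psum x) l) (hinf h (l := l)))| <=
  C * B * abs_psum x s.
Proof.
move=> n0 H.
pose S N := \sum_(l < s - 2) act family_of (flat R N) (edgeworth (power_sum (coords x)) l * 1).
have cS : S N @[N --> \oo] --> hinf h (0 : 'rV[R]_0) +
     \sum_(1 <= l < s - 2) dpoly_at0 (edgeworth (psum x) l) (hinf h (l := l)).
  have -> : S = fun N => \sum_(0 <= l < s - 2) act family_of (flat R N) (edgeworth (psum x) l).
    apply/funext => N; rewrite /S big_mkord; apply: eq_bigr => l _.
    by rewrite mulr1 power_sum_coords.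
  have s0 : (0 < s - 2)%N by lia.
  under eq_fun do rewrite big_ltn// edgeworth0 act1.
  apply: cvgD.
    rewrite hinfE (_ : coords 0 = [::]); last by apply: size0nil; rewrite size_coords.
    have s1 : (1 < s)%N by lia.
    exact: (@cvg_limit_family R s _ B family_of [::] family_of_regular s1 s0).
  apply: cvg_seq_sum => l; rewrite mem_index_iota => /andP[l1 ls].
  by apply: cvg_act; [exact: edgeworth_shape|lia].
have cL : `|act family_of (coords x) 1 - S N| @[N --> \oo] -->
   `|h x - (hinf h (0 : 'rV[R]_0) +
     \sum_(1 <= l < s - 2) dpoly_at0 (edgeworth (psum x) l) (hinf h (l := l)))|.
  by apply: cvg_norm; rewrite act1 family_of_coords//; apply: cvgB => //; exact: cvg_cst.
have cR : C * B * (abs_psum x s + delta R N) @[N --> \oo] --> C * B * abs_psum x s.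
  rewrite -[in X in _ --> X](addr0 (abs_psum x s)).
  apply: cvgM; first exact: cvg_cst.
  by apply: cvgD; [exact: cvg_cst|exact: cvg_delta].
apply: ler_cvg_to cL cR _; near=> N.
rewrite -abs_power_sum_coords; apply: H.
by near: N; exists 1%N.
Unshelve. all: by end_near. Qed.

End Family.
End Assembly.

(** * The Edgeworth expansion of symmetric functions *)

Theorem theorem2p2 (R : realType) (s : nat) (hs : (3 <= s)%N) :
  exists c : R,
  forall h : forall n : nat, 'rV[R]_n -> R,
  (forall (n : nat) (j : 'I_n.+1) (x : 'rV[R]_n), (0 < n)%N ->
    h n.+1 (insert0 j x) = h n x) ->
  (forall (n : nat) (j : 'I_n) (x : 'rV[R]_n), (0 < n)%N ->
    x 0 j = 0 -> is_derive x (delta_mx 0 j) (h n) 0) ->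
  (forall (n : nat) (sigma : 'S_n) (x : 'rV[R]_n), (0 < n)%N ->
    h n (col_perm sigma x) = h n x) ->
  forall B : R, 0 < B ->
  (forall (n : nat) (alpha : seq nat) (x : 'rV[R]_n), (0 < n)%N ->
    (size alpha <= n)%N -> admissible s alpha ->
    ex_Dmulti alpha (h n) x /\ `|Dmulti alpha (h n) x| <= B) ->
  [/\ forall (l : nat) (x : 'rV[R]_l), (l <= s - 3)%N ->
        cvgn (hinf_seq h x 1),
      forall (l : nat) (tau : nat -> R) (m : {cmonom nat}) (alpha : seq nat),
        (1 <= l <= s - 3)%N -> m \in msupp (edgeworth tau l) ->
        perm_eq alpha (factors m) ->
        ex_Dmulti alpha (hinf h (l := l)) 0
    & forall (n : nat) (eps : 'rV[R]_n), (0 < n)%N -> pnorm eps 2 = 1 ->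
        exists Rs : R,
          h n eps = hinf h (0 : 'rV[R]_0)
            + \sum_(1 <= l < s - 2) dpoly_at0 (edgeworth (psum eps) l) (hinf h (l := l))
            + Rs
          /\ `|Rs| <= c * B * abs_psum eps s].
Proof.
have J1 : (0 + (s - 3).+1 <= s - 2)%N by lia.
have J2 : (0 + (s - 3).+1 < s)%N by lia.
have [C C0 HC] := expansion (@shape1 R) J1 J2.
exists C => h h_zero h_flat h_perm B B0 h_bound; split.
- move=> l x _.
  exact: cvgP (cvg_hinf hs h_zero h_flat h_perm h_bound (x := x)).
- move=> l tau m alpha /andP[l1 ls] mP am.
  have /and3P[a2 /andP[_ sl] wl] := edgeworth_shape mP.
  apply: (ex_Dmulti_hinf hs h_zero h_flat h_perm h_bound).
    rewrite /adm (perm_size am) (perm_all _ am) a2 (weight_perm am).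
    by rewrite (leq_trans wl ls) (leq_trans sl)//; lia.
  by rewrite (perm_size am).
- move=> n eps n0 /pnorm_eq1 e1.
  pose main := hinf h (0 : 'rV[R]_0) +
    \sum_(1 <= l < s - 2) dpoly_at0 (edgeworth (psum eps) l) (hinf h (l := l)).
  exists (h n eps - main); split; first by rewrite addrC subrK.
  apply: (expansion_limit hs h_zero h_flat h_perm h_bound n0) => N N0.
  have rH := family_of_regular hs h_zero h_flat h_perm h_bound.
  have := HC B _ (coords eps) N rH _ N0.
  rewrite abs_power_sum_coords e1 => /(_ erefl).
  have -> : ((s - 3).+3 = s)%N by lia.
  by have -> : ((s - 3).+1 = s - 2)%N by lia.
Qed.
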